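(* For every $\varepsilon>0$ there exists $\delta_0=\delta_0(\varepsilon)$ such that the following holds for all $\delta\ge\delta_0$. Let $G=(V,E)$ be a graph with weighted lists of colours $(L,\mu)$. Suppose that for every edge $e\in E$: (a) $\mu(e)\colon L(e)\to\left[\exp(-\delta^{1/25}),\,\delta^{-1}\right]$; (b) $\sum_{c\in L(e)}\mu(e,c)\ge 1+\varepsilon$; (c) for every vertex $v\in V$ and every colour $c$, $\sum_{e\ni v,\ c\in L(e)}\mu(e,c)\le 1$. Then there is an $L$-edge-colouring of $G$.
   Context: Colours are positive integers. A weighted list assignment $(L,\mu)$ on the edges of $G$ consists of, for each edge $e$, a list $L(e)\subseteq\mathbb{N}$ of colours and a weight function $\mu(e)\colon L(e)\to(0,1]$; write $\mu(e,c)=\mu(e)(c)$. In (c) the sum is over edges $e$ incident to $v$ (with $c\in L(e)$). An $L$-edge-colouring assigns to each edge $e$ a colour from $L(e)$ such that edges sharing a vertex receive distinct colours. *)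

(* Defs.v *)
From HB Require Import structures.
From mathcomp Require Import all_boot all_order all_algebra.
From mathcomp Require Import reals sequences exp.
Set Implicit Arguments. Unset Strict Implicit. Unset Printing Implicit Defensive.
Import Order.TTheory GRing.Theory Num.Theory.
Local Open Scope ring_scope.

Definition simple_graph (V : finType) (E : {set {set V}}) : Prop :=
  forall e, e \in E -> #|e| = 2%N.

Definition colour_lists (V : finType) (E : {set {set V}})
  (L : {set V} -> seq nat) : Prop :=
  forall e, e \in E -> uniq (L e) /\ all (fun c => 0 < c)%N (L e).

Definition L_edge_colouring (V : finType) (E : {set {set V}})
  (L : {set V} -> seq nat) (col : {set V} -> nat) : Prop :=
  (forall e, e \in E -> col e \in L e) /\
  (forall e f, e \in E -> f \in E -> e != f -> e :&: f != set0 ->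
     col e != col f).

(* Main.v *)
Require Import Defs.
From HB Require Import structures.
From mathcomp Require Import all_boot all_order all_algebra.
From mathcomp Require Import reals sequences exp.
From mathcomp Require Import ring lra zify.
Import Order.TTheory GRing.Theory Num.Theory.
Local Open Scope ring_scope.
Set Implicit Arguments. Unset Strict Implicit. Unset Printing Implicit Defensive.

(** A nibble with boundedly many rounds.  In one round every pair (edge e,
    colour c) is hit independently with probability 1 - exp(-eta mu(e,c)); e
    takes c if no incident edge is hit in colour c, and c is deleted at all
    vertices covered by hit edges.  A pair (e,c) survives with probability
    about exp(-2 eta), while the load at a surviving pair (v,c) shrinks by
    exp(-eta) (deletions at the other ends of its edges) times
    exp(-eta exp(-2 eta) r) (edges leaving because they were coloured), where
    r is the list weight.  As r > 1, the ratio of list weight to load grows by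
    a constant factor; once it reaches 32, a random choice of colours from the
    lists succeeds by the local lemma.

    List weights and loads have the form sum_e u_e prod_k [e not in A_k] for
    independent random sets A_k with at most two elements: distinct colours
    are independent, and a vertex is covered at most once by the edges winning
    a given colour.  Such sums have Gaussian tails exp(-c t^2 / max mu), and
    the bad events depend on polynomially many others in exp(delta^(1/25)), so
    the symmetric local lemma applies to each round. *)

(** * Product measures and the local lemma *)

Section ProductMeasure.
Variables (R : realType) (I T : finType) (w : I -> T -> R).
Hypothesis w_ge0 : forall i t, 0 <= w i t.
Hypothesis w_sum1 : forall i, \sum_t w i t = 1.

Implicit Types (x y : {ffun I -> T}) (S : {set I}) (F G : {ffun I -> T} -> R).

Definition weight x : R := \prod_i w i (x i).
Definition Ex F : R := \sum_x weight x * F x.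
Definition Pr (A : {ffun I -> T} -> bool) : R := Ex (fun x => (A x)%:R).

Definition depends_on U S (F : {ffun I -> T} -> U) :=
  forall x y, (forall i, i \in S -> x i = y i) -> F x = F y.

Lemma weight_ge0 x : 0 <= weight x.
Proof. exact: prodr_ge0. Qed.

Lemma Ex_prod (F : I -> T -> R) :
  Ex (fun x => \prod_i F i (x i)) = \prod_i \sum_t w i t * F i t.
Proof.
rewrite bigA_distr_bigA /=; apply: eq_bigr => x _.
by rewrite /weight -big_split.
Qed.

Lemma eq_Ex F G : F =1 G -> Ex F = Ex G.
Proof. by move=> FG; apply: eq_bigr => x _; rewrite FG. Qed.

Lemma Ex_cst (a : R) : Ex (fun=> a) = a.
Proof.
rewrite /Ex -mulr_suml; have := Ex_prod (fun _ _ => 1).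
rewrite (eq_Ex (G := fun=> 1)); last by move=> x; rewrite big1.
rewrite /Ex -mulr_suml mulr1 => ->; rewrite big1 ?mul1r // => i _.
by rewrite -mulr_suml w_sum1 mul1r.
Qed.

Lemma ExD F G : Ex (fun x => F x + G x) = Ex F + Ex G.
Proof. by rewrite /Ex -big_split; apply: eq_bigr => x _; rewrite mulrDr. Qed.

Lemma ExZ a F : Ex (fun x => a * F x) = a * Ex F.
Proof. by rewrite /Ex mulr_sumr; apply: eq_bigr => x _; rewrite mulrCA. Qed.

Lemma Ex_sum (J : Type) (s : seq J) (P : pred J) (F : J -> {ffun I -> T} -> R) :
  Ex (fun x => \sum_(j <- s | P j) F j x) = \sum_(j <- s | P j) Ex (F j).
Proof.
rewrite /Ex exchange_big /=; apply: eq_bigr => x _; exact: mulr_sumr.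
Qed.

Lemma ler_Ex F G : (forall x, F x <= G x) -> Ex F <= Ex G.
Proof.
by move=> FG; apply: ler_sum => x _; apply: ler_wpM2l (FG x); apply: weight_ge0.
Qed.

Lemma Pr_ge0 A : 0 <= Pr A.
Proof. by apply: sumr_ge0 => x _; rewrite mulr_ge0 ?weight_ge0 ?ler0n. Qed.

Lemma Pr_le1 A : Pr A <= 1.
Proof. by rewrite -[leRHS]Ex_cst; apply: ler_Ex => x; rewrite lern1 leq_b1. Qed.

(* Exchanging the coordinates outside [S] of two independent copies is
   measure-preserving. *)
Lemma Ex_indep S S' F G : [disjoint S & S'] ->
  depends_on S F -> depends_on S' G -> Ex (fun x => F x * G x) = Ex F * Ex G.
Proof.
move=> dSS' FS GS'.
pose mix x y := [ffun i => if i \in S then x i else y i].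
pose sw (p : {ffun I -> T} * {ffun I -> T}) := (mix p.1 p.2, mix p.2 p.1).
have swK : involutive sw.
  by case=> x y; rewrite /sw /mix /=; congr (_, _); apply/ffunP=> i;
    rewrite !ffunE; case: (i \in S).
have FE x y : F (mix x y) = F x by apply: FS => i iS; rewrite ffunE iS.
have GE x y : G (mix x y) = G y.
  by apply: GS' => i iS'; rewrite ffunE (disjointFl dSS' iS').
have WE x y : weight (mix x y) * weight (mix y x) = weight x * weight y.
  rewrite /weight -!big_split /=; apply: eq_bigr => i _.
  by rewrite !ffunE; case: ifP => // _; rewrite mulrC.
transitivity (\sum_p weight p.1 * weight p.2 * (F p.1 * G p.1)).
  rewrite -(pair_bigA _ (fun x y => weight x * weight y * (F x * G x))) /=.
  apply: eq_bigr => x _; rewrite -mulr_suml -mulr_sumr.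
  by have := Ex_cst 1; rewrite /Ex -mulr_suml mulr1 => ->; rewrite mulr1.
rewrite (reindex_inj (inv_inj swK)) /=.
rewrite /Ex big_distrlr /= pair_bigA /=.
apply: eq_bigr => -[x y] _ /=; rewrite WE FE GE; ring.
Qed.

Lemma Pr_indep S S' (A B : {ffun I -> T} -> bool) : [disjoint S & S'] ->
  depends_on S A -> depends_on S' B -> Pr (fun x => A x && B x) = Pr A * Pr B.
Proof.
move=> dSS' AS BS'; rewrite -(Ex_indep dSS').
- by apply: eq_Ex => x; rewrite -natrM mulnb.
- by move=> x y /AS ->.
- by move=> x y /BS' ->.
Qed.

Lemma ler_Pr (A B : {ffun I -> T} -> bool) : (forall x, A x -> B x) -> Pr A <= Pr B.
Proof.
by move=> AB; apply: ler_Ex => x; rewrite ler_nat; case: (A x) (AB x) => // ->.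
Qed.

Lemma eq_Pr (A B : {ffun I -> T} -> bool) : A =1 B -> Pr A = Pr B.
Proof. by move=> AB; apply: eq_Ex => x; rewrite AB. Qed.

Lemma Pr_gt0_ex A : 0 < Pr A -> exists2 x, 0 < weight x & A x.
Proof.
move=> PA.
suff /existsP[x /andP[]] : [exists x, (0 < weight x) && A x] by exists x.
apply: contraLR PA => /existsPn nA; rewrite -leNgt; apply: sumr_le0 => x _.
have := nA x; case: (A x) => /=; last by rewrite mulr0.
by rewrite andbT -leNgt mulr1.
Qed.

Lemma Ex_coord (i : I) (F : T -> R) : Ex (fun x => F (x i)) = \sum_t w i t * F t.
Proof.
pose H j t := if j == i then F t else 1.
rewrite (eq_Ex (G := fun x => \prod_j H j (x j))); last first.
  move=> x; rewrite (bigD1 i) //= /H eqxx big1 ?mulr1 // => j.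
  by move=> /negbTE->.
rewrite Ex_prod (bigD1 i) //= /H eqxx [X in _ * X]big1 ?mulr1 // => j /negbTE->.
by rewrite -mulr_suml w_sum1 mulr1.
Qed.

Lemma Pr_compl A : Pr (fun x => ~~ A x) = 1 - Pr A.
Proof.
apply/eqP; rewrite eq_sym subr_eq -ExD; apply/eqP; rewrite -[LHS]Ex_cst.
by apply: eq_Ex => x; case: (A x); rewrite ?addr0 ?add0r.
Qed.

Lemma Pr_exists (J : finType) (P : pred J) (A : J -> {ffun I -> T} -> bool) :
  Pr (fun x => [exists j, P j && A j x]) <= \sum_(j | P j) Pr (A j).
Proof.
rewrite -Ex_sum; apply: ler_Ex => x; case: existsP => [[j /andP[Pj Aj]]|_].
  by rewrite (bigD1 j) //= Aj lerDl sumr_ge0.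
exact: sumr_ge0.
Qed.

(** * The symmetric local lemma *)

Section LocalLemma.
Variables (J : finType) (A : J -> {ffun I -> T} -> bool) (vb : J -> {set I}).
Hypothesis A_vb : forall j, depends_on (vb j) (A j).
(** The disjunct [j == i] makes [i] its own neighbour even when [vb i] is empty, so that [A_small]
    always bounds [Pr (A i)] as well. *)
Definition near (i j : J) := (j == i) || ~~ [disjoint vb i & vb j].
Hypothesis A_small : forall i, \sum_(j | near i j) Pr (A j) <= 1 / 4.

Definition avoid (S : {set J}) x := [forall j in S, ~~ A j x].

Lemma depends_avoid (S : {set J}) : depends_on (\bigcup_(j in S) vb j) (avoid S).
Proof.
move=> x y xy; apply: eq_forallb => j; case: (boolP (j \in S)) => //= jS.
by congr negb; apply: A_vb => i ij; apply: xy; apply/bigcupP; exists j.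
Qed.

(** The usual bound on a conditional probability, multiplied out to avoid dividing. Induction on
    [#|S|]: [A i] is independent of the far events [S2], and the union bound over the near ones,
    each at most [2 * Pr (A j) * Pr (avoid S2)], loses at most half of [Pr (avoid S2)]. *)
Lemma Pr_near i (S : {set J}) : i \notin S ->
  Pr (fun x => A i x && avoid S x) <= 2 * Pr (A i) * Pr (avoid S).
Proof.
have [k] := ubnP #|S|; elim: k i S => // k IHk i S ltSk iS.
pose S2 := [set j in S | ~~ near i j].
have sS2 : S2 \subset S by apply/subsetP => j; rewrite inE => /andP[].
have avS x : avoid S x -> avoid S2 x.
  move/forall_inP => avx; apply/forall_inP => j /(subsetP sS2); exact: avx.
have le1 : Pr (fun x => A i x && avoid S x) <= Pr (A i) * Pr (avoid S2).
  rewrite -(@Pr_indep (vb i) (\bigcup_(j in S2) vb j)) //.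
  - by apply: ler_Pr => x /andP[-> /avS].
  - rewrite disjoint_sym; apply/pred0P => z /=; apply/negP => /andP[/bigcupP[j]].
    rewrite inE /near negb_or => /and3P[_ _ /negPn dij] zj zi.
    by rewrite (disjointFr dij zi) in zj.
  - exact: depends_avoid.
suff le2 : Pr (avoid S2) <= 2 * Pr (avoid S).
  apply: le_trans le1 _; rewrite (mulrC 2) -mulrA ler_wpM2l ?Pr_ge0 //.
have [->|neS] := eqVneq S2 S; first by have := Pr_ge0 (avoid S); lra.
have ltS2 : (#|S2| < k)%N.
  apply: (@leq_trans #|S|) => //; apply: proper_card.
  by rewrite properEneq neS.
have le3 : Pr (avoid S2) <= Pr (avoid S) +
    \sum_(j | (j \in S) && near i j) Pr (fun x => A j x && avoid S2 x).
  apply: (@le_trans _ _ (Pr (avoid S) + Pr (fun x => [exists j, ((j \in S) && near i j)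
     && (A j x && avoid S2 x)]))); last by rewrite lerD2l; exact: Pr_exists.
  rewrite -ExD; apply: ler_Ex => x; rewrite -natrD ler_nat.
  case av2 : (avoid S2 x) => //; case av : (avoid S x) => //=.
  suff -> : [exists j, ((j \in S) && near i j) && (A j x && true)] by [].
  move/negbT: av; rewrite negb_forall => /existsP[j].
  rewrite negb_imply negbK => /andP[jS Aj]; apply/existsP; exists j.
  rewrite jS Aj !andbT /=; apply/negPn/negP => nij.
  by move/forall_inP: av2 => /(_ j); rewrite inE jS nij Aj => /(_ isT).
have le4 : \sum_(j | (j \in S) && near i j) Pr (fun x => A j x && avoid S2 x)
   <= (1/2) * Pr (avoid S2).
  apply: (@le_trans _ _ (\sum_(j | (j \in S) && near i j) 2 * Pr (A j) * Pr (avoid S2))).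
    apply: ler_sum => j /andP[jS nij]; apply: IHk => //.
    by rewrite inE nij andbF.
  rewrite -mulr_suml ler_wpM2r ?Pr_ge0 // -mulr_sumr.
  have : \sum_(j | (j \in S) && near i j) Pr (A j) <= 1/4.
    apply: le_trans (A_small i); rewrite [leRHS](bigID (mem S)) /=.
    under eq_bigl do rewrite andbC.
    by rewrite lerDl sumr_ge0 // => j _; exact: Pr_ge0.
  lra.
lra.
Qed.

(** Events are added one at a time; by [Pr_near] each one removes at most the fraction [2 * (1/4)]
    of a positive probability. *)
Theorem lovasz_local_lemma : exists2 x, 0 < weight x & forall j, ~~ A j x.
Proof.
suff : forall S : {set J}, 0 < Pr (avoid S).
  move/(_ setT) => /Pr_gt0_ex[x wx /forall_inP avx]; exists x => // j; exact: avx.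
move=> S; have [k] := ubnP #|S|; elim: k S => // k IHk S ltS.
have [->|[i iS]] := set_0Vmem S.
  rewrite (eq_Pr (B := fun=> true)); first by rewrite /Pr Ex_cst.
  move=> x.
  by apply/forall_inP => j; rewrite inE.
have gt0 : 0 < Pr (avoid (S :\ i)).
  by apply: IHk; rewrite (cardsD1 i) iS in ltS.
have h1 : Pr (avoid (S :\ i)) = Pr (avoid S) + Pr (fun x => A i x && avoid (S :\ i) x).
  rewrite -ExD; apply: eq_Ex => x; rewrite -natrD; congr _%:R.
  have -> : avoid S x = ~~ A i x && avoid (S :\ i) x.
    apply/forall_inP/andP => [av|[Ai /forall_inP av] j jS].
      by split; [exact: av|apply/forall_inP => j /setD1P[_]; exact: av].
    by have [->//|ji] := eqVneq j i; apply: av; rewrite !inE ji.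
  by case: (A i x) => /=; case: (avoid _ x).
have h2 : Pr (A i) <= 1/4.
  apply: le_trans (A_small i); rewrite (bigD1 i) ?/near ?eqxx //=.
  by rewrite lerDl sumr_ge0 // => j _; exact: Pr_ge0.
have := @Pr_near i (S :\ i); rewrite !inE eqxx /= => /(_ isT).
have : Pr (A i) * Pr (avoid (S :\ i)) <= 1/4 * Pr (avoid (S :\ i)).
  by apply: ler_wpM2r => //; exact: ltW.
rewrite -mulrA; lra.
Qed.

End LocalLemma.
End ProductMeasure.

Arguments eq_Ex {R I T w F} G _.
Arguments eq_Pr {R I T w A} B _.

(** * Concentration *)

(** The inequality exp(-y) >= 1 - y gives exp y <= 1/(1 - y), and (1 - y)(1 + y + 2y^2) = 1 + y^2(1
    - 2y) >= 1. *)
Lemma expR_le_quad (R : realType) (y : R) : y <= 1 / 2 -> expR y <= 1 + y + 2 * y ^+ 2.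
Proof.
move=> y2; have h := expR_ge1Dx (- y).
have e0 := expR_gt0 y.
have : expR y * (1 - y) <= 1.
  by rewrite -[leRHS](expRxMexpNx_1 y) ler_wpM2l // ltW.
have p0 : 0 <= y ^+ 2 * (1 - 2 * y) by rewrite mulr_ge0 ?sqr_ge0 //; lra.
move=> h2; have h3 : (1 - y) * expR y <= (1 - y) * (1 + y + 2 * y ^+ 2).
  have -> : (1 - y) * (1 + y + 2 * y ^+ 2) = 1 + y ^+ 2 * (1 - 2 * y) by ring.
  by rewrite mulrC; lra.
by rewrite ler_pM2l in h3 => //; lra.
Qed.

Section Concentration.
Variables (R : realType) (I T : finType) (w : I -> T -> R).
Hypothesis w_ge0 : forall i t, 0 <= w i t.
Hypothesis w_sum1 : forall i, \sum_t w i t = 1.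
Local Notation Ex := (Ex w).
Local Notation Pr := (Pr w).
Local Notation Omega := {ffun I -> T}.

Lemma mgf_centered (Y : Omega -> R) : Ex Y = 0 -> (forall x, Y x <= 1 / 2) ->
  Ex (fun x => expR (Y x)) <= expR (2 * Ex (fun x => Y x ^+ 2)).
Proof.
move=> EY Y2; apply: le_trans (expR_ge1Dx _).
rewrite -[X in X + _](addr0 1) -EY -[X in X + _ + _](Ex_cst w_sum1) -!(ExZ, ExD).
by apply: ler_Ex => // x; exact: expR_le_quad.
Qed.

Lemma Ex_partition (D : finType) (A : Omega -> D) (f : D -> Omega -> R) :
  Ex (fun x => f (A x) x) = \sum_d Ex (fun x => (A x == d)%:R * f d x).
Proof.
rewrite -Ex_sum; apply: eq_Ex => x; rewrite (bigD1 (A x)) //= eqxx mul1r.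
by rewrite big1 ?addr0 // => d; rewrite eq_sym => /negbTE->; rewrite mul0r.
Qed.

Variables (N K : finType) (A : K -> Omega -> {set N}) (B : K -> {set I}) (b : R).
Hypothesis A_B : forall k, depends_on (B k) (A k).
Hypothesis B_disj : forall k k', k != k' -> [disjoint B k & B k'].
Hypothesis A_le2 : forall k x, (#|A k x| <= 2)%N.
Hypothesis b_ge0 : 0 <= b.

Let hit k e := Pr (fun x => e \in A k x).

(** The weight [H] removed by one set lies in [[0, 2 * b]], because the set has at most two
    elements. Hence [H ^+ 2 <= 2 * b * H], and the variance is at most [2 * b] times the mean;
    [mgf_centered] then doubles it. *)
Lemma mgf_block (k : K) (u : N -> R) (l : R) :
  (forall e, 0 <= u e <= b) -> `|l| * (2 * b) <= 1 / 2 ->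
  Ex (fun x => expR (l * \sum_e u e * (e \notin A k x)%:R)) <=
  expR (l * (\sum_e u e * (1 - hit k e)) + l ^+ 2 * (4 * b * \sum_e u e * hit k e)).
Proof.
move=> ub lb.
pose H x := \sum_e u e * (e \in A k x)%:R.
pose m := \sum_e u e * hit k e.
have EH : Ex H = m by rewrite Ex_sum; apply: eq_bigr => e _; rewrite ExZ.
have H0 x : 0 <= H x.
  by apply: sumr_ge0 => e _; rewrite mulr_ge0 ?ler0n //; case/andP: (ub e).
have H2 x : H x <= 2 * b.
  apply: (@le_trans _ _ (\sum_(e in A k x) b)).
    rewrite [leRHS]big_mkcond; apply: ler_sum => e _.
    by case: (e \in A k x); rewrite ?mulr1 ?mulr0 //; case/andP: (ub e).
  rewrite sumr_const -[X in X <= _]mulr_natl; apply: ler_wpM2r => //.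
  by rewrite (ler_nat R _ 2).
have m0 : 0 <= m by rewrite -EH -(Ex_cst w_sum1 0); apply: ler_Ex.
have m2 : m <= 2 * b by rewrite -EH -(Ex_cst w_sum1 (2 * b)); apply: ler_Ex.
have XE x : \sum_e u e * (e \notin A k x)%:R = \sum_e u e * (1 - hit k e) + (m - H x).
  rewrite /m /H -sumrB -big_split; apply: eq_bigr => e _ /=.
  by case: (e \in A k x) => /=; rewrite ?mulr1n ?mulr0n; ring.
pose Y x := l * (m - H x).
rewrite (eq_Ex (fun x => expR (l * \sum_e u e * (1 - hit k e)) * expR (Y x))); last first.
  by move=> x; rewrite XE mulrDr expRD.
rewrite ExZ expRD ler_wpM2l ?expR_ge0 //.
apply: le_trans (mgf_centered _ _) _.
- rewrite /Y ExZ (eq_Ex (fun x => m + -1 * H x)); last by move=> x; ring.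
  by rewrite ExD (Ex_cst w_sum1) ExZ EH mulN1r subrr mulr0.
- move=> x; apply: le_trans (ler_norm _) _; rewrite normrM.
  apply: le_trans lb; apply: ler_wpM2l; first exact: normr_ge0.
  have := H0 x; have := H2 x; rewrite ler_norml => ? ?; apply/andP; split; lra.
rewrite ler_expR -/m -ExZ.
apply: (@le_trans _ _ (Ex (fun x => 2 * l ^+ 2 * (m ^+ 2 + ((2 * b - 2 * m) * H x))))).
  apply: ler_Ex => // x; rewrite /Y exprMn mulrA ler_wpM2l //.
    by rewrite mulr_ge0 ?sqr_ge0.
  have -> : (m - H x) ^+ 2 = m ^+ 2 + ((2 * b - 2 * m) * H x) - (2 * b - H x) * H x by ring.
  by rewrite gerBl mulr_ge0 // subr_ge0.
rewrite ExZ ExD (Ex_cst w_sum1) ExZ EH.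
have -> : l ^+ 2 * (4 * b * m) = 2 * l ^+ 2 * (2 * b * m) by ring.
apply: ler_wpM2l; first exact: mulr_ge0 (ler0n _ 2) (sqr_ge0 l).
have := sqr_ge0 m.
have -> : m ^+ 2 + (2 * b - 2 * m) * m = 2 * b * m - m ^+ 2 by ring.
lra.
Qed.

(** Induction on [s], conditioning on the value [D] of [A k]: the remaining sets are independent of
    it and act on the weights [u] with [D] zeroed out. Their means are absorbed into the factors
    [g e <= 1], and [mgf_block] handles the average over [A k]. *)
Lemma mgf_indep (s : seq K) (u : N -> R) (l : R) : uniq s ->
  (forall e, 0 <= u e <= b) -> `|l| * (2 * b) <= 1 / 2 ->
  Ex (fun x => expR (l * \sum_e u e * \prod_(k <- s) (e \notin A k x)%:R)) <=
  expR (l * (\sum_e u e * \prod_(k <- s) (1 - hit k e)) +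
        l ^+ 2 * \sum_(k <- s) 4 * b * \sum_e u e * hit k e).
Proof.
move=> us ub lb; elim: s u us ub => [|k s IHs] u /=.
  move=> _ _; rewrite big_nil mulr0 addr0 (eq_Ex (fun=> expR (l * \sum_e u e))).
    rewrite (Ex_cst w_sum1) ler_expR; under [in leRHS]eq_bigr do rewrite big_nil mulr1.
    by [].
  by move=> x; under eq_bigr do rewrite big_nil mulr1.
move=> /andP[ks us] ub.
pose h (D : {set N}) x := expR (l * \sum_e (u e * (e \notin D)%:R) *
  \prod_(k <- s) (e \notin A k x)%:R).
pose g e := \prod_(k <- s) (1 - hit k e).
pose V := \sum_(k <- s) 4 * b * \sum_e u e * hit k e.
have hit0 k' e : 0 <= hit k' e by apply: Pr_ge0.
have hit1 k' e : hit k' e <= 1 by apply: Pr_le1.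
have g0 e : 0 <= g e by apply: prodr_ge0 => k' _; rewrite subr_ge0.
have g1 e : g e <= 1.
  by apply: prodr_ile1 => k' _; rewrite subr_ge0 hit1 lerBlDr lerDl hit0.
rewrite (eq_Ex (fun x => h (A k x) x)); last first.
  by move=> x; rewrite /h; congr (expR (_ * _)); apply: eq_bigr => e _; rewrite big_cons mulrA.
rewrite (Ex_partition (A k)).
have ub' (D : {set N}) e : 0 <= u e * (e \notin D)%:R <= b.
  by case: (e \notin D); rewrite ?mulr1 ?mulr0 ?lexx.
pose r (D : {set N}) (x : Omega) := expR (l * \sum_e (u e * (e \notin D)%:R) * g e + l ^+ 2 * V).
apply: (@le_trans _ _ (\sum_D Ex (fun x => (A k x == D)%:R * r D x))).
  apply: ler_sum => D _.
  rewrite (@Ex_indep _ _ _ _ w_sum1 (B k) (\bigcup_(k' in [set k' in s]) B k')).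
  - rewrite (@Ex_indep _ _ _ _ w_sum1 (B k) (\bigcup_(k' in [set k' in s]) B k')) //.
    + apply: ler_wpM2l; first exact: Pr_ge0.
      rewrite (Ex_cst w_sum1); apply: le_trans (IHs _ us (ub' D)) _.
      rewrite ler_expR lerD2l ler_wpM2l ?sqr_ge0 //.
      apply: ler_sum => k' _; rewrite ler_wpM2l ?mulr_ge0 //.
      apply: ler_sum => e _; rewrite ler_wpM2r //.
      by case/andP: (ub e) => ? ?; case: (e \notin D); rewrite ?mulr1 ?mulr0.
    + rewrite disjoint_sym; apply/pred0P => z /=; apply/negP => /andP[/bigcupP[k']].
      rewrite inE => k's zk' zk; have kk' : k' != k by apply: contraNneq ks => <-.
      by rewrite (disjointFr (B_disj kk') zk') in zk.
    + by move=> x y xy; rewrite (A_B xy).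
  - rewrite disjoint_sym; apply/pred0P => z /=; apply/negP => /andP[/bigcupP[k']].
    rewrite inE => k's zk' zk; have kk' : k' != k by apply: contraNneq ks => <-.
    by rewrite (disjointFr (B_disj kk') zk') in zk.
  - by move=> x y xy; rewrite (A_B xy).
  - move=> x y xy; rewrite /h; congr (expR (_ * _)); apply: eq_bigr => e _; congr (_ * _).
    rewrite !big_seq; apply: eq_bigr => k' k's.
    rewrite (@A_B k' x y) // => i iB; apply: xy; apply/bigcupP; exists k' => //.
    by rewrite inE.
rewrite -(Ex_partition (A k) r).
pose u' e := u e * g e.
rewrite (eq_Ex (fun x => expR (l ^+ 2 * V) * expR (l * \sum_e u' e * (e \notin A k x)%:R))); last first.
  move=> x; rewrite /r expRD mulrC; congr (_ * expR (_ * _)); apply: eq_bigr => e _.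
  by rewrite /u' mulrAC.
have u'b e : 0 <= u' e <= b.
  by case/andP: (ub e) => u0 u1; rewrite /u' mulr_ge0 //= (le_trans _ u1) // ler_piMr.
rewrite ExZ; apply: le_trans (ler_wpM2l (expR_ge0 _) (mgf_block k u'b lb)) _.
rewrite -expRD ler_expR big_cons -/V mulrDr addrCA.
have -> : \sum_e u e * \prod_(k0 <- k :: s) (1 - hit k0 e) = \sum_e u' e * (1 - hit k e).
  by apply: eq_bigr => e _; rewrite big_cons /u' /g mulrCA mulrA (mulrC (_ - _)) mulrAC.
rewrite lerD2l addrC lerD2r ler_wpM2l ?sqr_ge0 // ler_wpM2l ?mulr_ge0 //.
apply: ler_sum => e _; rewrite ler_wpM2r // ler_piMr //.
by case/andP: (ub e).
Qed.

Variable (u : N -> R).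
Hypothesis ub : forall e, 0 <= u e <= b.
Let Z (x : Omega) := \sum_e u e * \prod_k (e \notin A k x)%:R.
Let mean := \sum_e u e * \prod_k (1 - hit k e).
Variable v : R.
Hypothesis v_ge : \sum_k \sum_e u e * hit k e <= v.

Lemma mgf_all l : `|l| * (2 * b) <= 1 / 2 ->
  Ex (fun x => expR (l * Z x)) <= expR (l * mean + l ^+ 2 * (4 * b * v)).
Proof.
move=> lb; apply: le_trans (mgf_indep (index_enum_uniq _) ub lb) _.
rewrite ler_expR lerD2l ler_wpM2l ?sqr_ge0 // -mulr_sumr ler_wpM2l //.
by rewrite mulr_ge0.
Qed.

(** Markov's inequality for [expR (l * Z x)]; the sign of [l] selects the tail. *)
Lemma Pr_chernoff l t (A0 : Omega -> bool) : `|l| * (2 * b) <= 1 / 2 ->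
  (forall x, A0 x -> `|l| * t <= l * (Z x - mean)) ->
  Pr A0 <= expR (l ^+ 2 * (4 * b * v) - `|l| * t).
Proof.
move=> lb A0t.
apply: (@le_trans _ _ (Ex (fun x => expR (- (l * mean) - `|l| * t) * expR (l * Z x)))).
  apply: ler_Ex => // x; case: (boolP (A0 x)) => [/A0t h|_] /=.
    by rewrite -expRD -expR0 ler_expR; lra.
  by rewrite mulr_ge0 ?expR_ge0.
rewrite ExZ; apply: le_trans (ler_wpM2l (expR_ge0 _) (mgf_all lb)) _.
by rewrite -expRD ler_expR; lra.
Qed.

(** This [l] minimises the quadratic exponent, and [t <= 2 * v] keeps it within the range where
    [mgf_all] applies. *)
Lemma tail_exponent t : 0 < b -> 0 < v -> 0 <= t <= 2 * v ->
  let l := t / (8 * b * v) in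
  `|l| * (2 * b) <= 1 / 2 /\ l ^+ 2 * (4 * b * v) - `|l| * t = - (t ^+ 2 / (16 * b * v)).
Proof.
move=> b0 v0 /andP[t0 tv] l; have l0 : 0 <= l by rewrite divr_ge0 // !mulr_ge0 // ltW.
rewrite ger0_norm //; split.
  have -> : l * (2 * b) = t / (4 * v) by rewrite /l; field; rewrite !gt_eqF.
  by rewrite ler_pdivrMr ?mulr_gt0 //; lra.
by rewrite /l; field; rewrite !gt_eqF.
Qed.

Lemma upper_tail t : 0 < b -> 0 < v -> 0 <= t <= 2 * v ->
  Pr (fun x => mean + t <= Z x) <= expR (- (t ^+ 2 / (16 * b * v))).
Proof.
move=> b0 v0 tv; have [] := tail_exponent b0 v0 tv; set l := t / _ => lb <-.
apply: Pr_chernoff => // x hx; rewrite ger0_norm; last first.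
  by case/andP: tv => t0 _; rewrite divr_ge0 // !mulr_ge0 // ltW.
rewrite ler_wpM2l //; last by lra.
by case/andP: tv => t0 _; rewrite divr_ge0 // !mulr_ge0 // ltW.
Qed.

Lemma lower_tail t : 0 < b -> 0 < v -> 0 <= t <= 2 * v ->
  Pr (fun x => Z x <= mean - t) <= expR (- (t ^+ 2 / (16 * b * v))).
Proof.
move=> b0 v0 tv; have [] := tail_exponent b0 v0 tv; set l := t / _ => lb <-.
have l0 : 0 <= l by case/andP: tv => t0 _; rewrite divr_ge0 // !mulr_ge0 // ltW.
rewrite -sqrrN -normrN; apply: Pr_chernoff => [|x hx]; first by rewrite normrN.
rewrite normrN ger0_norm // mulNr -mulrN ler_wpM2l //; lra.
Qed.

End Concentration.

(** * Long lists *)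

Section Colouring.
Variables (R : realType) (V C : finType).
Implicit Types (E : {set {set V}}) (mu : {set V} -> C -> R).

Definition touch (e f : {set V}) := e :&: f != set0.

Lemma touchP (e f : {set V}) : reflect (exists2 v, v \in e & v \in f) (touch e f).
Proof.
apply: (iffP (set0Pn _)) => [[v /setIP[]]|[v ve vf]]; first by exists v.
by exists v; rewrite inE ve.
Qed.

Lemma touchC (e f : {set V}) : touch e f = touch f e.
Proof. by rewrite /touch setIC. Qed.

(** The list of [e] is encoded as the support of [mu e]. *)
Definition colourable E mu := exists col : {set V} -> C,
  (forall e, e \in E -> 0 < mu e (col e)) /\
  (forall e f, e \in E -> f \in E -> e != f -> touch e f -> col e != col f).

Definition load E mu v c := \sum_(e in E | v \in e) mu e c.

Lemma load_touch E mu (g : {set V}) c : (forall e c, 0 <= mu e c) ->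
  (forall v c, load E mu v c <= 1) -> (#|g| <= 2)%N ->
  \sum_(f in E | touch g f) mu f c <= 2.
Proof.
move=> mu0 ld g2; apply: (@le_trans _ _ (\sum_(v in g) load E mu v c)).
  rewrite /load (exchange_big_dep (mem E)) /=; last by move=> v f _ /andP[].
  rewrite big_mkcondr; apply: ler_sum => f fE.
  case: touchP => [[v vg vf]|_]; last exact: sumr_ge0.
  by rewrite (bigD1 v) ?vg ?fE //= lerDl sumr_ge0.
apply: (@le_trans _ _ (\sum_(v in g) 1)); first exact: ler_sum.
by rewrite sumr_const (ler_nat R _ 2).
Qed.

(** Each edge draws a colour with probability proportional to [mu e], and a bad event is a touching
    pair drawing the same colour. The local lemma applies because a colour at [e] meets total weight
    at most 2 among touching edges, and each of these draws it with probability at most its weight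
    divided by 32. *)
Lemma colourable_of_long_lists E mu (c0 : C) : simple_graph E ->
  (forall e c, 0 <= mu e c) -> (forall e, e \in E -> 32 <= \sum_c mu e c) ->
  (forall v c, load E mu v c <= 1) -> colourable E mu.
Proof.
move=> sE mu0 ge32 ld.
pose l e := \sum_c mu e c.
(* Sets outside [E] receive [c0] deterministically, so that every coordinate carries a probability
   measure. *)
pose w e c := if e \in E then mu e c / l e else (c == c0)%:R.
have l0 e : e \in E -> 0 < l e by move/ge32; apply: lt_le_trans.
have w0 e c : 0 <= w e c.
  by rewrite /w; case: ifP => // /l0 /ltW ?; rewrite divr_ge0.
have w1 e : \sum_c w e c = 1.
  rewrite /w; case eE: (e \in E); first by rewrite -mulr_suml divff // gt_eqF ?l0.
  by rewrite (bigD1 c0) //= eqxx big1 ?addr0 // => c /negbTE->.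
pose A (p : {set V} * {set V}) (x : {ffun {set V} -> C}) :=
  [&& p.1 \in E, p.2 \in E, p.1 != p.2, touch p.1 p.2 & x p.1 == x p.2].
pose vb (p : {set V} * {set V}) : {set {set V}} := [set p.1; p.2].
have A_vb p : depends_on (vb p) (A p).
  by move=> x y xy; rewrite /A !xy // !inE eqxx ?orbT.
pose P p := Pr w (A p).
have P0 p : 0 <= P p by apply: Pr_ge0.
have PC e f : P (e, f) = P (f, e).
  by apply: eq_Pr => x; rewrite /A /= touchC (eq_sym e) (eq_sym (x e)) andbCA.
have Pe e f : P (e, f) <= if [&& e \in E, f \in E & touch e f] then
   \sum_c w e c * (mu f c / 32) else 0.
  rewrite /P; case: ifPn => [/and3P[eE fE ef]|nef]; last first.
    rewrite (eq_Pr (fun=> false)) /Pr ?Ex_cst // => x; rewrite /A /=.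
    by apply/negbTE; apply: contra nef => /and5P[-> -> _ ->].
  have [<-|neq] := eqVneq e f.
    rewrite (eq_Pr (fun=> false)) /Pr ?Ex_cst //; last by move=> x; rewrite /A /= eqxx !andbF.
    by apply: sumr_ge0 => c _; rewrite mulr_ge0 ?w0 ?divr_ge0.
  rewrite (eq_Pr (fun x => x e == x f)); last by move=> x; rewrite /A /= eE fE neq ef.
  rewrite /Pr (eq_Ex (fun x => \sum_c (x e == c)%:R * (x f == c)%:R)); last first.
    move=> x; rewrite (bigD1 (x e)) //= eqxx mul1r big1 ?addr0 1?eq_sym //.
    by move=> c; rewrite eq_sym => /negbTE->; rewrite mul0r.
  rewrite Ex_sum; apply: ler_sum => c _.
  rewrite (@Ex_indep _ _ _ _ w1 [set e] [set f]); first last.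
  - by move=> x y xy; rewrite xy ?inE.
  - by move=> x y xy; rewrite xy ?inE.
  - by rewrite disjoints1 inE.
  have Ec g : Ex w (fun x => (x g == c)%:R) = w g c.
    rewrite (Ex_coord w1 g (fun t => (t == c)%:R)) (bigD1 c) //= eqxx mulr1.
    by rewrite big1 ?addr0 // => t /negbTE->; rewrite mulr0.
  rewrite !Ec ler_wpM2l ?w0 // {1}/w fE ler_wpM2l //.
  by rewrite lef_pV2 ?posrE ?l0 ?ge32.
have sumP g : \sum_f P (g, f) <= 1 / 16.
  apply: le_trans (ler_sum _ (fun f _ => Pe g f)) _.
  rewrite -big_mkcond; case gE : (g \in E) => /=; last by rewrite big_pred0 //; lra.
  rewrite exchange_big /= -[leRHS]mul1r -[X in _ <= X * _](w1 g) mulr_suml.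
  apply: ler_sum => c _; rewrite -mulr_sumr ler_wpM2l ?w0 // -mulr_suml.
  by have := load_touch c mu0 ld (eq_leq (sE _ gE)); lra.
have [|x wx avx] := @lovasz_local_lemma R _ _ w w0 w1 _ A vb A_vb.
  move=> [e f].
  have sum1 g : \sum_(p : {set V} * {set V}) (p.1 == g)%:R * P p <= 1 / 16.
    apply: le_trans (sumP g).
    rewrite -(pair_bigA _ (fun a b => (a == g)%:R * P (a, b))) /= (bigD1 g) //=.
    rewrite [X in _ + X]big1; last first.
      by move=> a /negbTE->; rewrite big1 // => b _; rewrite mul0r.
    by rewrite addr0; apply: ler_sum => b _; rewrite eqxx mul1r.
  have sum2 g : \sum_(p : {set V} * {set V}) (p.2 == g)%:R * P p <= 1 / 16.
    rewrite (reindex_inj (inv_inj (_ : involutive (fun p : {set V} * {set V} => (p.2, p.1))))) /=.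
      apply: le_trans (sum1 g); apply: ler_sum => -[a b] _ /=.
      by rewrite PC.
    by case.
  (* A neighbouring pair has its first or second entry equal to [e] or [f]; each of these four
     families has total probability at most 1/16. *)
  have : \sum_(p | near vb (e, f) p) P p <= \sum_(p : {set V} * {set V})
     ((p.1 == e)%:R * P p + (p.1 == f)%:R * P p + ((p.2 == e)%:R * P p + (p.2 == f)%:R * P p)).
    rewrite big_mkcond; apply: ler_sum => -[a b] _ /=; rewrite -!mulrDl.
    case: ifPn => nab; last by rewrite mulr_ge0 // !addr_ge0.
    rewrite ler_peMl // -!natrD (ler_nat R 1) !addnA.
    move: nab; rewrite /near xpair_eqE => /orP[/andP[/eqP-> _]|]; first by rewrite eqxx.
    case/pred0Pn => z /=; rewrite !inE /= => /andP[/orP[] /eqP->] /orP[] /eqP->;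
      rewrite eqxx; lia.
  rewrite !big_split /=.
  have := sum1 e; have := sum1 f; have := sum2 e; have := sum2 f; lra.
exists x; split.
  (* An outcome of positive weight draws every colour with positive probability, hence from the
     list. *)
  move=> e eE; have : 0 < w e (x e).
    rewrite lt_def w0 andbT; apply: contraTneq wx => we0.
    by rewrite /weight (bigD1 e) //= we0 mul0r ltxx.
  by rewrite /w eE pmulr_lgt0 // invr_gt0 l0.
by move=> e f eE fE ef t; have := avx (e, f); rewrite /A /= eE fE ef t.
Qed.

End Colouring.

(** * One round of the nibble *)

(** The parameter [b] controls concentration and [r] measures progress; [n] only counts dependencies
    between bad events and stays fixed during the rounds. *)
Record weighted_lists (R : realType) (V C : finType) (n : nat) (b r : R)
    (E : {set {set V}}) (mu : {set V} -> C -> R) : Prop := WeightedLists {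
  lists_simple : simple_graph E;
  lists_bound : forall e c, 0 <= mu e c <= b;
  lists_load : forall v c, load E mu v c <= 1;
  lists_weight : forall e, e \in E -> r <= \sum_c mu e c;
  lists_degree : forall v c, (#|[set e in E | (v \in e) && (0 < mu e c)%R]| <= n)%N;
  lists_size : forall e, e \in E -> (#|[set c | (0 < mu e c)%R]| <= n)%N
}.

Lemma card_bigcup_le (I T : finType) (A : {set I}) (F : I -> {set T}) (m : nat) :
  (forall i, i \in A -> (#|F i| <= m)%N) -> (#|\bigcup_(i in A) F i| <= #|A| * m)%N.
Proof.
move=> Fm; rewrite -sum_nat_const; elim/big_rec2: _ => [|i k X iA IH].
  by rewrite cards0.
by rewrite cardsU; apply: leq_trans (leq_subr _ _) _; rewrite leq_add // Fm.
Qed.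

Section Nibble.
Variables (R : realType) (V C : finType) (E : {set {set V}}) (mu : {set V} -> C -> R).
Variables (eta b r : R) (n : nat).
Hypothesis wl : weighted_lists n b r E mu.
Hypothesis le_33 : forall e, e \in E -> \sum_c mu e c <= 33.
Hypothesis eta01 : 0 < eta <= 1.

Implicit Types (e i : {set V}) (c : C) (v : V).

Let eta0 : 0 <= eta. Proof. by case/andP: eta01 => /ltW. Qed.
Let sE : simple_graph E := lists_simple wl.
Let mu_b : forall e c, 0 <= mu e c <= b := lists_bound wl.
Let load_le1 : forall v c, load E mu v c <= 1 := lists_load wl.
Let ge_r : forall e, e \in E -> r <= \sum_c mu e c := lists_weight wl.

Let mu0 e c : 0 <= mu e c. Proof. by case/andP: (mu_b e c). Qed.
Let mub e c : mu e c <= b. Proof. by case/andP: (mu_b e c). Qed.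

(* The singleton [set u] is a dummy item bringing the load at [(u, c)] to
   exactly 1, so that every pair [(u, c)] is hit with the same probability. *)
Definition nu (i : {set V}) (c : C) : R :=
  if i \in E then mu i c
  else if #|i| == 1%N then 1 - \sum_(e in E | i \subset e) mu e c else 0.

Lemma nu_edge e c : e \in E -> nu e c = mu e c.
Proof. by rewrite /nu => ->. Qed.

Lemma set1_notin_edges v : ([set v] \in E) = false.
Proof. by apply/negP => /sE; rewrite cards1. Qed.

Lemma nu_set1 v c : nu [set v] c = 1 - load E mu v c.
Proof.
rewrite /nu set1_notin_edges cards1 eqxx; congr (_ - _).
by apply: eq_bigl => e; rewrite sub1set.
Qed.

Lemma nu_ge0 i c : 0 <= nu i c.
Proof.
have [iE|iE] := boolP (i \in E); first by rewrite nu_edge.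
have [/cards1P[v ->]|i1] := boolP (#|i| == 1%N).
  by rewrite nu_set1 subr_ge0.
by rewrite /nu (negbTE iE) (negbTE i1).
Qed.

Lemma nu_eq0 i c : i \notin E -> #|i| != 1%N -> nu i c = 0.
Proof. by rewrite /nu => /negbTE-> /negbTE->. Qed.

Lemma nu_card i c : 0 < nu i c -> (#|i| <= 2)%N.
Proof.
have [/sE->//|iE] := boolP (i \in E).
by have [/eqP->//|i1] := boolP (#|i| == 1%N); rewrite nu_eq0 // ltxx.
Qed.

Lemma nu_load v c : \sum_(i : {set V} | v \in i) nu i c = 1.
Proof.
rewrite (bigID (mem E)) /= [X in _ + X](bigD1 [set v]) /=; last first.
  by rewrite !inE eqxx set1_notin_edges.
rewrite [X in _ + (_ + X)]big1 ?addr0; last first.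
  move=> i /andP[/andP[vi iE] iv]; apply: nu_eq0 => //.
  apply: contra iv => /cards1P[u iu]; move: vi; rewrite iu inE => /eqP->.
  by [].
rewrite nu_set1 [X in X + _](_ : _ = load E mu v c); first by rewrite addrC subrK.
rewrite /load; under eq_bigl do rewrite andbC.
by apply: eq_bigr => i /andP[iE _]; rewrite nu_edge.
Qed.

Lemma edge_other e v : e \in E -> v \in e -> exists2 u, u != v & e = [set v; u].
Proof.
move=> eE ve; have /cards2P[x [y [xy eq_e]]] : #|e| == 2%N by rewrite sE.
move: ve; rewrite eq_e !inE => /orP[]/eqP->.
  by exists y; rewrite // eq_sym.
by exists x; rewrite // setUC.
Qed.

(** Dummies are singletons and the graph has no parallel edges, so the edge is the only item of
    nonzero weight containing both ends. *)
Lemma nu_pair u v c : u != v -> [set v; u] \in E ->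
  \sum_(i : {set V} | (v \in i) && (u \in i)) nu i c = mu [set v; u] c.
Proof.
move=> uv eE; rewrite (bigD1 [set v; u]) /=; last by rewrite !inE !eqxx orbT.
rewrite big1 ?addr0 ?nu_edge // => i /andP[/andP[vi ui] ne].
have sub : [set v; u] \subset i by apply/subsetP => z /set2P[]->.
have c2 : #|[set v; u]| = 2%N by rewrite cards2 eq_sym uv.
apply: nu_eq0.
  apply: contra ne => /sE ci; rewrite eq_sym eqEcard sub ci c2 //.
by have := subset_leq_card sub; rewrite c2; case: #|i| => // -[].
Qed.

(** These are the items through the other end of [e], of total weight 1, apart from [e] itself. *)
Lemma nu_touch_other e v c : e \in E -> v \in e ->
  \sum_(i | touch i e && (v \notin i)) nu i c = 1 - mu e c.
Proof.
move=> eE ve; have [u uv eq_e] := edge_other eE ve.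
rewrite -(nu_load u c) [in RHS](bigID (fun i : {set V} => v \in i)) /=.
rewrite [X in _ = X + _ - _](_ : _ = mu e c); last first.
  by rewrite eq_e -nu_pair -?eq_e //; apply: eq_bigl => i; rewrite andbC.
rewrite addrAC subrr add0r; apply: eq_bigl => i.
case vi : (v \in i) => /=; rewrite ?andbF // !andbT eq_e.
apply/touchP/idP => [[z zi]|ui]; last by exists u; rewrite // !inE eqxx orbT.
by rewrite !inE => /orP[]/eqP zE; move: zi; rewrite zE // vi.
Qed.

Lemma nu_touch e c : e \in E -> \sum_(i | touch i e) nu i c = 2 - mu e c.
Proof.
move=> eE; have /card_gt0P[v ve] : (0 < #|e|)%N by rewrite sE.
rewrite (bigID (fun i : {set V} => v \in i)) /= nu_touch_other //.
rewrite (eq_bigl (fun i : {set V} => v \in i)) ?nu_load; first by ring.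
by move=> i; apply: andb_idl => vi; apply/touchP; exists v.
Qed.

Lemma touch_refl e : e \in E -> touch e e.
Proof. by move=> eE; rewrite /touch setIid -card_gt0 sE. Qed.

Lemma nu_touch_ne e c : e \in E ->
  \sum_(i | touch i e && (i != e)) nu i c = 2 - 2 * mu e c.
Proof.
move=> eE; have := nu_touch c eE; rewrite (bigD1 e) /= ?touch_refl // nu_edge //.
lra.
Qed.

(** * Coins, hits and winning probabilities *)

Definition coin (p : {set V} * C) (t : bool) : R :=
  if t then 1 - expR (- (eta * nu p.1 p.2)) else expR (- (eta * nu p.1 p.2)).

Lemma coin_ge0 p t : 0 <= coin p t.
Proof.
case: t; rewrite /coin ?expR_ge0 // subr_ge0 -[leRHS]expR0 ler_expR oppr_le0.
by rewrite mulr_ge0 ?nu_ge0.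
Qed.

Lemma coin_sum1 p : \sum_t coin p t = 1.
Proof. by rewrite big_bool /= /coin subrK. Qed.

Local Notation Omega := {ffun {set V} * C -> bool}.
Local Notation Pr := (Pr coin).
Implicit Types (x y : Omega).

(** A coin of weight 0 is heads with probability 0; the guard lets events ignore such coins
    outright, which keeps their sets of variables small. *)
Definition on x i c := x (i, c) && (0 < nu i c).
Definition quiet (P : pred {set V}) c x := [forall i, P i ==> ~~ on x i c].
Definition won e c x := on x e c && quiet (fun i => touch i e && (i != e)) c x.

(** This exact identity is the purpose of the exponential form of [coin]: independent factors add up
    in the exponent. *)
Lemma Pr_quiet (P : pred {set V}) c : Pr (quiet P c) = expR (- (eta * \sum_(i | P i) nu i c)).
Proof.
pose F (p : {set V} * C) t : R :=
  (((p.2 == c) && P p.1) ==> ~~ (t && (0 < nu p.1 p.2)))%:R.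
rewrite /Pr (eq_Ex (fun x => \prod_p F p (x p))); last first.
  move=> x; rewrite /quiet; case: forallP => [h|nh] /=.
    rewrite big1 // => -[i c'] _; rewrite /F /=; case: eqP => //= ->.
    by have := h i; rewrite /on => ->.
  suff /existsP[i] : [exists i, P i && on x i c].
    by rewrite /on => /andP[Pi /andP[xi ni]]; rewrite (bigD1 (i, c)) //= /F eqxx Pi xi ni mul0r.
  apply: contra_notT nh => /existsPn h i; have := h i.
  by rewrite negb_and implybE.
rewrite Ex_prod -(pair_bigA _ (fun i c' => \sum_t coin (i, c') t * F (i, c') t)) /=.
rewrite mulr_sumr -sumrN expR_sum [RHS]big_mkcond; apply: eq_bigr => i _.
rewrite (bigD1 c) //= [X in _ * X]big1 ?mulr1; last first.
  move=> c' /negbTE cc'; under eq_bigr do rewrite /F /= cc' mulr1.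
  exact: coin_sum1.
rewrite big_bool /F /= eqxx /=; case: (P i) => /=; last first.
  by rewrite !mulr1 /coin subrK.
rewrite /coin /=; have := nu_ge0 i c; rewrite le_eqVlt => /predU1P[<-|->] /=.
  by rewrite ltxx mulr0 oppr0 expR0 subrr mul0r mulr1 add0r.
by rewrite mulr0 mulr1 add0r.
Qed.

Lemma Pr_on i c : Pr (fun x => on x i c) = 1 - expR (- (eta * nu i c)).
Proof.
have <- : Pr (quiet (pred1 i) c) = expR (- (eta * nu i c)).
  by rewrite Pr_quiet big_pred1_eq.
rewrite -(Pr_compl coin_sum1); apply: eq_Pr => x; rewrite negb_forall.
apply/idP/existsP => [oi|[j]]; first by exists i; rewrite /= eqxx oi.
by rewrite negb_imply negbK /= => /andP[/eqP->].
Qed.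

Lemma Pr_on_le i c : Pr (fun x => on x i c) <= eta * nu i c.
Proof. by rewrite Pr_on; have := expR_ge1Dx (- (eta * nu i c)); lra. Qed.

(** Winning means that all other touching items are unhit but [e] is not, so its probability is a
    difference of two [quiet] probabilities. *)
Lemma Pr_won e c : e \in E -> Pr (won e c) =
  expR (- (eta * (2 - 2 * mu e c))) - expR (- (eta * (2 - mu e c))).
Proof.
move=> eE; rewrite -(nu_touch_ne c eE) -(nu_touch c eE) -!Pr_quiet.
apply/eqP; rewrite eq_sym subr_eq -ExD; apply/eqP/eq_Ex => x; rewrite -natrD; congr _%:R.
have -> : quiet (fun i => touch i e) c x =
   ~~ on x e c && quiet (fun i => touch i e && (i != e)) c x.
  apply/forallP/andP => [h|[ne /forallP h] i].
    split; first by have := h e; rewrite touch_refl.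
    by apply/forallP => i; apply/implyP => /andP[ti _]; have := h i; rewrite ti.
  by have [->|nie] := eqVneq i e; [rewrite ne implybT | have := h i; rewrite nie andbT].
by rewrite /won; case: (on x e c); case: (quiet _ _ _).
Qed.

Lemma Pr_won_ge e c : e \in E -> expR (- (2 * eta)) * (eta * mu e c) <= Pr (won e c).
Proof.
move=> eE; rewrite Pr_won //; set m := mu e c; have m0 : 0 <= m by apply: mu0.
have -> : - (eta * (2 - 2 * m)) = - (2 * eta) + (eta * m + eta * m) by ring.
have -> : - (eta * (2 - m)) = - (2 * eta) + eta * m by ring.
rewrite !expRD -mulrBr ler_wpM2l ?expR_ge0 //.
(* With x = [eta * m], what remains is exp x * (exp x - 1) >= x, which follows from exp x >= 1 +
   x. *)
have h := expR_ge1Dx (eta * m); have h0 : 0 <= eta * m by rewrite mulr_ge0.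
by nra.
Qed.

Lemma Pr_won_le e c : e \in E -> Pr (won e c) <= eta * mu e c.
Proof.
move=> eE; rewrite -(nu_edge c eE); apply: le_trans (Pr_on_le e c).
by apply: ler_Pr => [|x /andP[]//]; apply: coin_ge0.
Qed.

Lemma depends_quiet (B : {set {set V} * C}) (P : pred {set V}) c :
  (forall i, P i -> 0 < nu i c -> (i, c) \in B) -> depends_on B (quiet P c).
Proof.
move=> PB x y xy; apply: eq_forallb => i; case Pi : (P i) => //=; rewrite /on.
by case ni : (0 < nu i c); rewrite ?andbF // xy // PB.
Qed.

Lemma depends_won (B : {set {set V} * C}) e c : e \in E ->
  (forall i, touch i e -> 0 < nu i c -> (i, c) \in B) -> depends_on B (won e c).
Proof.
move=> eE PB x y xy; rewrite /won /on.
rewrite (@depends_quiet B _ c _ x y) //; last by move=> i /andP[] /PB.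
by case ni : (0 < nu e c); rewrite ?andbF // xy // PB ?touch_refl.
Qed.

(** * Concentration of list weights and loads *)

Definition kept_weight e x := \sum_c mu e c * (quiet (fun i => touch i e) c x)%:R.

(** Distinct colours use disjoint sets of coins, so the concentration bound applies with one set per
    colour, empty or a singleton. A colour survives with probability exp(-eta (2 - mu)) >= exp(-2
    eta). *)
Lemma kept_weight_tail e t : e \in E -> 0 < b -> 0 <= t <= 68 ->
  Pr (fun x => kept_weight e x <= expR (- (2 * eta)) * r - t) <=
  expR (- (t ^+ 2 / (544 * b))).
Proof.
move=> eE b0 t68.
pose A c x : {set C} := if quiet (fun i => touch i e) c x then set0 else [set c].
pose B c : {set {set V} * C} := [set p | p.2 == c].
have A_B c : depends_on (B c) (A c).
  by move=> x y xy; rewrite /A (@depends_quiet (B c) _ c _ x y) // => i _ _; rewrite inE.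
have B_disj c c' : c != c' -> [disjoint B c & B c'].
  move=> cc'; apply/pred0P => p /=; rewrite !inE; apply/negP => /andP[/eqP-> /eqP h].
  by rewrite h eqxx in cc'.
have A2 c x : (#|A c x| <= 2)%N by rewrite /A; case: ifP; rewrite ?cards0 ?cards1.
have hitE c c' : Pr (fun x => c \in A c' x) =
    if c' == c then 1 - expR (- (eta * (2 - mu e c))) else 0.
  case: eqVneq => [->|cc'].
    rewrite -nu_touch // -Pr_quiet -(Pr_compl coin_sum1); apply: eq_Pr => x.
    by rewrite /A; case: (quiet _ _ _); rewrite inE ?eqxx.
  rewrite (eq_Pr (fun=> false)) /Pr ?(Ex_cst coin_sum1) // => x; rewrite /A.
  by case: ifP; rewrite !inE // eq_sym (negbTE cc').
have ex1 c : expR (- (eta * (2 - mu e c))) <= 1.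
  rewrite -[leRHS]expR0 ler_expR oppr_le0 mulr_ge0 // -nu_touch // sumr_ge0 // => i _.
  exact: nu_ge0.
(* The value 34 matches the one needed for loads, so that both tails share 544 = 16 * 34 and the
   range [t <= 68]. *)
have vb : \sum_c' \sum_c mu e c * Pr (fun x => c \in A c' x) <= 34.
  rewrite exchange_big /=; apply: (@le_trans _ _ 33); last by lra.
  apply: le_trans (le_33 eE); apply: ler_sum => c _; rewrite -mulr_sumr.
  rewrite (bigD1 c) //= big1 ?addr0; last first.
    by move=> c' /negbTE cc'; rewrite hitE cc'.
  by rewrite hitE eqxx ler_piMr // gerBl expR_ge0.
have v0 : 0 < 34 :> R by lra.
have t68' : 0 <= t <= 2 * 34 by lra.
have := lower_tail coin_ge0 coin_sum1 A_B B_disj A2 (ltW b0) (mu_b e) vb b0 v0 t68'.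
rewrite (_ : 16 * b * 34 = 544 * b); last by ring.
apply: le_trans; apply: ler_Pr => [|x hx]; first exact: coin_ge0.
rewrite (eq_bigr (fun c => mu e c * (quiet (fun i => touch i e) c x)%:R)); last first.
  move=> c _; congr (_ * _); rewrite (bigD1 c) //= big1 ?mulr1; last first.
    by move=> c' cc'; rewrite /A; case: ifP; rewrite !inE // eq_sym (negbTE cc').
  by rewrite /A; case: ifP; rewrite !inE ?eqxx.
apply: le_trans hx _; rewrite lerD2r.
apply: (@le_trans _ _ (expR (- (2 * eta)) * \sum_c mu e c)).
  by rewrite ler_wpM2l ?expR_ge0 // ge_r.
rewrite mulr_sumr; apply: ler_sum => c _; rewrite mulrC ler_wpM2l //.
rewrite (bigD1 c) //= big1 ?mulr1; last first.
  by move=> c' /negbTE cc'; rewrite hitE cc' subr0.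
rewrite hitE eqxx opprB addrCA subrr addr0 ler_expR lerN2 mulrC ler_wpM2r //.
by rewrite gerBl.
Qed.


(* The sum in [load_bound] has independent factors and dominates the load at
   [(v, c)] after the round whenever [c] is not deleted at [v]: items through
   [v] and the winners of [c] itself are ignored. *)
Definition loser (v : V) (c : C) (k : {set V} + C) x : {set {set V}} :=
  match k with
  | inl i => if on x i c && (v \notin i) then [set e in E | (v \in e) && touch i e] else set0
  | inr c' => if c' == c then set0 else [set e in E | (v \in e) && won e c' x]
  end.

Definition load_bound v c x :=
  \sum_e (if (e \in E) && (v \in e) then mu e c else 0) *
    \prod_k (e \notin loser v c k x)%:R.

(** An item missing [v] meets only those edges at [v] that end in one of its at most two vertices;
    two edges at [v] cannot both win the same colour. *)
Lemma loser_card v c k x : (#|loser v c k x| <= 2)%N.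
Proof.
case: k => [i|c'] /=; case: ifP; rewrite ?cards0 //.
  move=> /andP[/andP[_ /nu_card i2] vi]; apply: leq_trans i2.
  apply: leq_trans (leq_imset_card (fun u => [set v; u]) i).
  apply: subset_leq_card; apply/subsetP => e; rewrite inE => /and3P[eE ve /touchP[u ui ue]].
  have [u' _ eq_e] := edge_other eE ve; apply/imsetP; exists u => //.
  move: ue; rewrite eq_e !inE => /orP[]/eqP uE; last by rewrite uE.
  by move: vi; rewrite -uE ui.
move=> _; apply: (@leq_trans 1) => //; apply/card_le1_eqP => e f.
rewrite !inE => /and3P[eE ve /andP[one /forallP qe]] /and3P[fE vf /andP[onf _]].
apply/eqP/negPn/negP => fe; have := qe f; rewrite fe onf andbT implybF.
by case/touchP; exists v.
Qed.

(** In colour [c] every item is a block of its own, while any other colour forms one block; leaving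
    [c] out of the second kind keeps blocks disjoint. *)
Definition loser_block (c : C) (k : {set V} + C) : {set {set V} * C} :=
  match k with
  | inl i => [set (i, c)]
  | inr c' => if c' == c then set0 else [set p | p.2 == c']
  end.

Lemma depends_loser v c k : depends_on (loser_block c k) (loser v c k).
Proof.
move=> x y; rewrite /loser_block; case: k => [i|c'] xy /=; first by rewrite /on xy ?inE.
case: eqP xy => // _ xy; apply/setP => e; rewrite !inE.
case eE : (e \in E) => //; congr (_ && (_ && _)).
by apply: (@depends_won [set p | p.2 == c']) => // i _ _; rewrite inE.
Qed.

Lemma expRN_le1 (y : R) : 0 <= y -> expR (- y) <= 1.
Proof. by move=> y0; rewrite -[leRHS]expR0 ler_expR oppr_le0. Qed.

Lemma load_bound_tail v c t : 0 < b -> 0 <= t <= 68 ->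
  Pr (fun x => expR (- (eta * (1 - b)) - eta * expR (- (2 * eta)) * (r - b)) + t
     <= load_bound v c x) <= expR (- (t ^+ 2 / (544 * b))).
Proof.
move=> b0 t68.
pose u e := if (e \in E) && (v \in e) then mu e c else 0.
have ub e : 0 <= u e <= b by rewrite /u; case: ifP => _; rewrite ?mu_b // lexx ltW.
set M := expR (_ - _).
have B_disj k k' : k != k' -> [disjoint loser_block c k & loser_block c k'].
  move=> kk'; apply/pred0P => -[i c2] /=; apply/negP => /andP[].
  rewrite /loser_block; case: k k' kk' => [j|c'] [j'|c''] kk'.
  - by rewrite !inE => /eqP[-> _] /eqP[jj]; rewrite jj eqxx in kk'.
  - rewrite !inE => /eqP[_ ->]; case: eqP => cc; rewrite inE //=.
    by move=> /eqP/esym.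
  - case: eqP => cc; rewrite !inE //= => /eqP c2E /eqP[_ h].
    by case: cc; rewrite -c2E.
  - case: ifP => _; rewrite ?inE //; case: ifP => _; rewrite ?inE ?andbF //=.
    by move=> /eqP h1 /eqP h2; rewrite -h1 -h2 eqxx in kk'.
have hitl i e : Pr (fun x => e \in loser v c (inl i) x) =
   if [&& e \in E, v \in e, touch i e & v \notin i] then 1 - expR (- (eta * nu i c)) else 0.
  case: ifP => [/and4P[eE ve ti vi]|nt].
    rewrite -Pr_on; apply: eq_Pr => x /=; rewrite vi andbT.
    by case: (on x i c); rewrite inE // eE ve ti.
  rewrite (eq_Pr (fun=> false)) /Pr ?(Ex_cst coin_sum1) // => x /=.
  case: ifP; rewrite !inE // => /andP[_ vi]; apply/negP => /and3P[eE ve ti].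
  by rewrite eE ve ti vi in nt.
have hitr c' e : Pr (fun x => e \in loser v c (inr c') x) =
   if [&& e \in E, v \in e & c' != c] then Pr (won e c') else 0.
  case: ifP => [/and3P[eE ve cc']|nt].
    by apply: eq_Pr => x /=; rewrite (negbTE cc') inE eE ve.
  rewrite (eq_Pr (fun=> false)) /Pr ?(Ex_cst coin_sum1) // => x /=.
  case: eqP nt => [_ _|_]; rewrite !inE //.
  by case: (e \in E); case: (v \in e).
have vb : \sum_k \sum_e u e * Pr (fun x => e \in loser v c k x) <= 34.
  rewrite exchange_big /=.
  apply: (@le_trans _ _ (\sum_e u e * 34)); last first.
    rewrite -mulr_suml /u -big_mkcond /=.
    by have := load_le1 v c; rewrite /load; lra.
  apply: ler_sum => e _; rewrite -mulr_sumr /u.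
  case: ifP => [/andP[eE ve]|]; last by rewrite !mul0r.
  rewrite ler_wpM2l // big_sumType /=.
  (* Hits at the other end of [e] contribute at most 1, and wins of other colours at most the list
     weight. *)
  have -> : (34 : R) = 1 + 33 by ring.
  apply: lerD.
    apply: (@le_trans _ _ (\sum_(i | touch i e && (v \notin i)) nu i c)).
      rewrite [leRHS]big_mkcond; apply: ler_sum => i _; rewrite hitl eE ve /=.
      case: ifP => // _; rewrite -Pr_on; apply: le_trans (Pr_on_le i c) _.
      by rewrite ler_piMl ?nu_ge0 //; case/andP: eta01.
    by rewrite nu_touch_other // gerBl.
  apply: le_trans (le_33 eE); apply: ler_sum => c' _; rewrite hitr eE ve /=.
  case: ifP => // _; apply: le_trans (Pr_won_le c' eE) _.
  by rewrite ler_piMl //; case/andP: eta01.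
have v0 : 0 < 34 :> R by lra.
have t68' : 0 <= t <= 2 * 34 by lra.
have := upper_tail coin_ge0 coin_sum1 (@depends_loser v c) B_disj (loser_card v c) (ltW b0) ub vb b0 v0 t68'.
rewrite (_ : 16 * b * 34 = 544 * b); last by ring.
apply: le_trans; apply: ler_Pr => [|x hx]; first exact: coin_ge0.
apply: le_trans hx; rewrite lerD2r.
apply: (@le_trans _ _ (\sum_e u e * M)); last first.
  rewrite -mulr_suml ler_piMl ?expR_ge0 //.
  by have := load_le1 v c; rewrite /load big_mkcond.
apply: ler_sum => e _; rewrite /u; case: ifP => [/andP[eE ve]|]; last by rewrite !mul0r.
rewrite ler_wpM2l // big_sumType /= /M expRD.
apply: ler_pM.
- by apply: prodr_ge0 => i _; rewrite subr_ge0 Pr_le1 //; [exact: coin_ge0|exact: coin_sum1].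
- by apply: prodr_ge0 => i _; rewrite subr_ge0 Pr_le1 //; [exact: coin_ge0|exact: coin_sum1].
(* Items at the other end of [e]: their non-hit probabilities multiply to exp(-eta (1 - mu)). *)
- rewrite (eq_bigr (fun i => if touch i e && (v \notin i) then expR (- (eta * nu i c)) else 1)).
    rewrite -big_mkcond -expR_sum sumrN -mulr_sumr nu_touch_other // ler_expR lerN2.
    by rewrite ler_wpM2l // lerD2l lerN2.
  by move=> i _; rewrite hitl eE ve /=; case: ifP => _; rewrite ?subr0 // opprB addrCA subrr addr0.
(* Wins of other colours: 1 - p <= exp(-p) with the lower bound [Pr_won_ge]; omitting [c] costs at
   most [b] of the list weight. *)
- apply: (@le_trans _ _ (\prod_c' expR (- (if c' != c then expR (- (2 * eta)) * (eta * mu e c') else 0)))).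
    apply: ler_prod => c' _; rewrite subr_ge0 Pr_le1; [|exact: coin_ge0|exact: coin_sum1].
    rewrite /= hitr eE ve /=; case: ifP => _; last by rewrite subr0 oppr0 expR0.
    have := Pr_won_ge c' eE; set h := _ * _ => hh.
    by have := expR_ge1Dx (- h); lra.
  rewrite -expR_sum sumrN -big_mkcond ler_expR lerN2 -mulr_sumr -mulr_sumr.
  rewrite mulrCA mulrA ler_wpM2l ?mulr_ge0 ?expR_ge0 //.
  have := ge_r eE; rewrite (bigD1 c) //=; have := mub e c; lra.
Qed.


(** * Dependencies between bad events *)

Definition zone e : {set {set V} * C} :=
  [set p | [&& 0 < nu p.1 p.2, 0 < mu e p.2 & touch p.1 e]].

Definition edges_at v c := [set e in E | (v \in e) && (0 < mu e c)].

Lemma mu_eq0 e c : (0 < mu e c) = false -> mu e c = 0.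
Proof. by have := mu0 e c; rewrite le_eqVlt => /predU1P[<-|->]. Qed.

Lemma depends_kept_weight e : depends_on (zone e) (kept_weight e).
Proof.
move=> x y xy; apply: eq_bigr => c _; case me : (0 < mu e c); last first.
  by rewrite mu_eq0 // !mul0r.
rewrite (@depends_quiet (zone e) _ c _ x y) // => i ti ni.
by rewrite inE /= ni me ti.
Qed.

Lemma depends_load_bound v c :
  depends_on (\bigcup_(e in edges_at v c) zone e) (load_bound v c).
Proof.
move=> x y xy; apply: eq_bigr => e _; case: ifP => [/andP[eE ve]|]; last by rewrite !mul0r.
case me : (0 < mu e c); last by rewrite mu_eq0 // !mul0r.
congr (_ * _); apply: eq_bigr => k _; congr (~~ _)%:R.
have xye p : p \in zone e -> x p = y p.
  by move=> pe; apply: xy; apply/bigcupP; exists e; rewrite // inE eE ve.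
case: k => [i|c'] /=.
  rewrite /on; case ni : (0 < nu i c); last by rewrite !andbF.
  case ti : (touch i e); first by rewrite xye // inE /= ni me.
  by do 2![case: ifP]; rewrite !inE ?ti ?andbF.
case: ifP => // _; rewrite !inE eE ve /=.
case me' : (0 < mu e c'); last by rewrite /won /on nu_edge // me' !andbF.
apply: (@depends_won (zone e)) => // i ti ni.
by rewrite inE /= ni me' ti.
Qed.

Hypothesis n_gt0 : (0 < n)%N.

(** The extra 1 is the dummy item at [u]. *)
Lemma card_items u c : (#|[set i : {set V} | (u \in i) && (0 < nu i c)%R]| <= n.+1)%N.
Proof.
apply: (@leq_trans #|[set u] |: edges_at u c|); last first.
  rewrite cardsU1; apply: (@leq_trans (1 + n)%N) => //.
  by apply: leq_add (lists_degree wl u c); apply: leq_b1.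
apply: subset_leq_card; apply/subsetP => i; rewrite !inE => /andP[ui ni].
have [iE|iE] := boolP (i \in E); first by rewrite ui -nu_edge // ni orbT.
have [/cards1P[v iv]|i1] := boolP (#|i| == 1%N).
  by move: ui; rewrite iv inE => /eqP->; rewrite eqxx.
by rewrite nu_eq0 // ltxx in ni.
Qed.

(** There are at most [n] colours, two ends, and [n.+1] items at each end. *)
Lemma card_zone e : e \in E -> (#|zone e| <= n * (2 * n.+1))%N.
Proof.
move=> eE; pose F c := \bigcup_(u in e)
  ((fun i => (i, c)) @: [set i : {set V} | (u \in i) && (0 < nu i c)]).
apply: (@leq_trans #|\bigcup_(c in [set c | 0 < mu e c]) F c|).
  apply: subset_leq_card; apply/subsetP => -[i c]; rewrite inE /=.
  case/and3P => ni me /touchP[u ui ue]; apply/bigcupP; exists c; rewrite ?inE //.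
  by apply/bigcupP; exists u => //; apply/imsetP; exists i; rewrite ?inE ?ui.
apply: (leq_trans (card_bigcup_le _)) (leq_mul (lists_size wl eE) (leqnn _)).
move=> c _; rewrite -(sE eE); apply: card_bigcup_le => u _.
exact: leq_trans (leq_imset_card _ _) (card_items u c).
Qed.

Lemma card_zone_mem p : (#|[set e in E | p \in zone e]| <= 2 * n)%N.
Proof.
have [np|np] := boolP (0 < nu p.1 p.2); last first.
  rewrite (_ : [set e in E | _] = set0) ?cards0 //; apply/setP => e.
  by rewrite !inE (negbTE np) andbF.
apply: (@leq_trans #|\bigcup_(u in p.1) edges_at u p.2|).
  apply: subset_leq_card; apply/subsetP => e; rewrite !inE np /= => /and3P[eE me].
  by case/touchP => u up ue; apply/bigcupP; exists u; rewrite // inE eE ue.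
apply: (leq_trans (card_bigcup_le _)) (leq_mul (nu_card np) (leqnn _)).
by move=> u _; apply: (lists_degree wl).
Qed.

(* Bad events are indexed by edges (list weight) and by pairs vertex-colour
   (load); each depends on the coins in the zones of its core edges. *)
Definition core (j : {set V} + V * C) : {set {set V}} :=
  match j with
  | inl e => if e \in E then [set e] else set0
  | inr p => edges_at p.1 p.2
  end.

Definition scope j := \bigcup_(e in core j) zone e.

Lemma core_edge j e : e \in core j -> e \in E.
Proof.
case: j => [f|p] /=; last by rewrite inE => /andP[].
by case: ifP => fE; rewrite inE // => /eqP->.
Qed.

Lemma card_core j : (#|core j| <= n)%N.
Proof.
case: j => [f|p] /=; last exact: (lists_degree wl).
by case: ifP; rewrite ?cards0 ?cards1.
Qed.

(** An edge owns its list event, and occurs in the load event of each of its two ends for each of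
    its at most [n] colours. *)
Lemma card_owners e : e \in E -> (#|[set j | e \in core j]| <= 1 + 2 * n)%N.
Proof.
move=> eE; pose F v : {set {set V} + V * C} :=
  (fun c => inr (v, c)) @: [set c | (0 < mu e c)%R].
apply: (@leq_trans #|inl e |: \bigcup_(v in e) F v|); last first.
  rewrite cardsU1; apply: leq_add; first exact: leq_b1.
  rewrite -{1}(sE eE); apply: card_bigcup_le => v _.
  exact: leq_trans (leq_imset_card _ _) (lists_size wl eE).
apply: subset_leq_card; apply/subsetP => j; rewrite !inE.
case: j => [f|[v c]] /=; first by case: ifP => _; rewrite inE // => /eqP->; rewrite eqxx.
rewrite inE => /and3P[_ ve me]; apply/bigcupP; exists v => //.
by apply/imsetP; exists c; rewrite ?inE.
Qed.

(** A neighbour is reached from [i] through a core edge, a coin in its zone, an edge whose zone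
    shares that coin, and an owner of that edge. The four counts multiply to at most [24 * n ^ 5],
    and [i] itself is added. *)
Lemma card_near (i : {set V} + V * C) : (#|[set j | near scope i j]| <= 25 * n ^ 5)%N.
Proof.
pose meet e := \bigcup_(p in zone e) [set f in E | p \in zone f].
apply: (@leq_trans #|i |: \bigcup_(e in core i) \bigcup_(f in meet e) [set j | f \in core j]|).
  apply: subset_leq_card; apply/subsetP => j; rewrite inE /near => /orP[/eqP->|].
    by rewrite !inE eqxx.
  case/pred0Pn => p /= /andP[/bigcupP[e ei pe] /bigcupP[f fj pf]].
  rewrite inE; apply/orP; right; apply/bigcupP; exists e => //.
  apply/bigcupP; exists f; last by rewrite inE.
  by apply/bigcupP; exists p; rewrite // inE pf (core_edge fj).
rewrite cardsU1.
have h : (#|\bigcup_(e in core i) \bigcup_(f in meet e) [set j | f \in core j]| <=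
   n * (n * (2 * n.+1) * (2 * n) * (1 + 2 * n)))%N.
  apply: (leq_trans (card_bigcup_le _)) (leq_mul (card_core i) (leqnn _)).
  move=> e /core_edge eE.
  apply: (@leq_trans (#|meet e| * (1 + 2 * n))%N).
    apply: card_bigcup_le => f /bigcupP[p _]; rewrite inE => /andP[fE _].
    exact: card_owners.
  rewrite leq_mul2r; apply/orP; right.
  apply: (leq_trans (card_bigcup_le _)) (leq_mul (card_zone eE) (leqnn _)).
  by move=> p _; apply: card_zone_mem.
apply: leq_trans (leq_add (leq_b1 _) h) _.
have h5 : (n ^ 5 = n * (n * n * n) * n)%N by rewrite !expnS expn0; ring.
rewrite h5; have : (1 <= n * (n * n * n) * n)%N by rewrite !muln_gt0 n_gt0.
have : (n * (n * (2 * n.+1) * (2 * n) * (1 + 2 * n)) <= n * (n * (2 * (2 * n)) * (2 * n) * (3 * n)))%N.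
  by rewrite !leq_mul //; lia.
have -> : (n * (n * (2 * (2 * n)) * (2 * n) * (3 * n)) = 24 * (n * (n * n * n) * n))%N by ring.
lia.
Qed.

(** * The outcome of a round *)

Variable t : R.
Hypothesis b_gt0 : 0 < b.
Hypothesis t68 : 0 <= t <= 68.
Hypothesis q_small : 100 * n%:R ^+ 5 * expR (- (t ^+ 2 / (544 * b))) <= 1.

Lemma nibble_outcome : exists x,
  (forall e, e \in E -> expR (- (2 * eta)) * r - t <= kept_weight e x) /\
  (forall v c, load_bound v c x <=
     expR (- (eta * (1 - b)) - eta * expR (- (2 * eta)) * (r - b)) + t).
Proof.
pose bad (j : {set V} + V * C) x := match j with
  | inl e => (e \in E) && (kept_weight e x <= expR (- (2 * eta)) * r - t)
  | inr p => expR (- (eta * (1 - b)) - eta * expR (- (2 * eta)) * (r - b)) + t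
       <= load_bound p.1 p.2 x
  end.
have bad_scope j : depends_on (scope j) (bad j).
  move=> x y xy; case: j xy => [e|p] xy; rewrite /bad; last first.
    by rewrite (depends_load_bound xy).
  case eE : (e \in E) => //; congr (_ <= _); apply: depends_kept_weight => p pe.
  by apply: xy; apply/bigcupP; exists e; rewrite //= eE inE.
have Pr_bad j : Pr (bad j) <= expR (- (t ^+ 2 / (544 * b))).
  case: j => [e|[v c]]; last exact: load_bound_tail.
  case eE : (e \in E); first by rewrite /bad eE; apply: kept_weight_tail.
  by rewrite (eq_Pr (fun=> false)) /Pr ?(Ex_cst coin_sum1) ?expR_ge0 // => x; rewrite /bad eE.
have [|x _ good] := lovasz_local_lemma coin_ge0 coin_sum1 bad_scope.
  move=> i; apply: le_trans (ler_sum _ (fun j _ => Pr_bad j)) _.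
  rewrite (eq_bigl (fun j => j \in [set j | near scope i j])); last by move=> j; rewrite inE.
  rewrite sumr_const -[X in X <= _]mulr_natl.
  (* The factor 100 in [q_small] is the 25 of [card_near] times the 4 of the local lemma. *)
  have : #|[set j | near scope i j]|%:R <= 25 * n%:R ^+ 5 :> R.
    by rewrite -natrX -natrM ler_nat card_near.
  move=> hc; apply: le_trans (ler_wpM2r (expR_ge0 _) hc) _; move: q_small; set q := _ * expR _.
  set q' := _ * expR _; have -> : q = 4 * q' by rewrite /q /q'; ring.
  lra.
exists x; split => [e eE|v c].
  by have := good (inl e); rewrite /bad eE /= -ltNge => /ltW.
by have := good (inr (v, c)); rewrite /bad /= -ltNge => /ltW.
Qed.

(** The residual instance consists of edges that won nothing and of surviving colours, with weights
    divided by [Lam] to bring loads back below 1. Its colourings extend by the colours won. *)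
Lemma nibble_step (Lam r' : R) : 0 < Lam ->
  expR (- (eta * (1 - b)) - eta * expR (- (2 * eta)) * (r - b)) + t <= Lam ->
  r' * Lam <= expR (- (2 * eta)) * r - t ->
  exists (E' : {set {set V}}) (mu' : {set V} -> C -> R), weighted_lists n (b / Lam) r' E' mu' /\
    (colourable E' mu' -> colourable E mu).
Proof.
move=> Lam0 leLam r'Lam; have [x [kept bound]] := nibble_outcome.
pose E' := [set e in E | [forall c, ~~ won e c x]].
pose mu' e c := if quiet (fun i => touch i e) c x then mu e c / Lam else 0.
have E'E e : e \in E' -> e \in E by rewrite inE => /andP[].
have mu'le e c : 0 < mu' e c -> 0 < mu e c.
  by rewrite /mu'; case: ifP; rewrite ?ltxx // pmulr_lgt0 ?invr_gt0.
have mu'E e c : mu' e c = mu e c * (quiet (fun i => touch i e) c x)%:R / Lam.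
  by rewrite /mu'; case: ifP; rewrite ?mulr1 ?mulr0 ?mul0r.
exists E', mu'; split; first split.
- by move=> e /E'E /sE.
- move=> e c; rewrite /mu'; case: ifP => _; last by rewrite lexx divr_ge0 // ltW.
  by rewrite divr_ge0 ?(ltW Lam0) //= ler_pM2r ?invr_gt0.
- move=> v c; apply: (@le_trans _ _ (load_bound v c x / Lam)); last first.
    by rewrite ler_pdivrMr // mul1r (le_trans (bound v c)).
  rewrite /load; under eq_bigr do rewrite mu'E.
  rewrite -mulr_suml ler_pM2r ?invr_gt0 // big_mkcond; apply: ler_sum => e _.
  case: ifP => [/andP[eE' ve]|_]; last first.
    by rewrite mulr_ge0 ?prodr_ge0 //; case: ifP.
  have eE := E'E e eE'; rewrite eE ve /= ler_wpM2l //.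
  (* If [c] survives at [e], no touching item is hit in [c], and [e] has won nothing; so [e] is in
     no loser set and all factors are 1. *)
  case: (boolP (quiet _ c x)) => [/forallP qt|_] /=; last exact: prodr_ge0.
  rewrite big1 // => -[i|c'] _ /=; rewrite (_ : _ \in _ = false) //.
    case: ifP; rewrite !inE // => /andP[oi _].
    by have := qt i; rewrite oi implybF => /negbTE->; rewrite !andbF.
  case: ifP; rewrite !inE //.
  by move: eE'; rewrite inE => /andP[_ /forallP /(_ c') /negbTE->]; rewrite !andbF.
- move=> e /E'E eE; under eq_bigr do rewrite mu'E.
  by rewrite -mulr_suml ler_pdivlMr // (le_trans r'Lam) ?kept.
- move=> v c; apply: leq_trans (lists_degree wl v c).
  apply: subset_leq_card; apply/subsetP => e; rewrite !inE.
  by case/and3P => /andP[-> _] -> /mu'le ->.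
- move=> e /E'E eE; apply: leq_trans (lists_size wl eE).
  by apply: subset_leq_card; apply/subsetP => c; rewrite !inE => /mu'le.
move=> [col' [col'_list col'_proper]].
pose col e := if [pick c | won e c x] is Some c then c else col' e.
have colP e : e \in E -> (e \in E' /\ col e = col' e) \/ (won e (col e) x).
  move=> eE; rewrite /col; case: pickP => [c wc|nw]; [by right|left; split => //].
  by rewrite inE eE; apply/forallP => c; rewrite nw.
(* A colour won by [f] is hit at [f], hence was deleted from the list of every touching edge. *)
have clash e f : e \in E' -> col e = col' e -> won f (col f) x -> touch e f -> col e != col f.
  move=> eE' ce /andP[onf _] ef; apply: contraTneq onf => <-.
  have := col'_list e eE'; rewrite -ce /mu'; case: ifP; rewrite ?ltxx //.
  by move=> /forallP /(_ f); rewrite touchC ef.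
exists col; split.
  move=> e eE; case: (colP e eE) => [[eE' ->]|/andP[/andP[_]]].
    by apply: mu'le; apply: col'_list.
  by rewrite nu_edge.
move=> e f eE fE ef tef.
case: (colP e eE) (colP f fE) => [[eE' ce]|we] [[fE' cf]|wf].
- by rewrite ce cf; apply: col'_proper.
- exact: clash.
- by rewrite eq_sym; apply: clash => //; rewrite touchC.
case/andP: we => _ /forallP /(_ f); rewrite touchC tef eq_sym ef /=.
by apply: contraNneq => ->; case/andP: wf.
Qed.

End Nibble.

(** * Iteration *)

(** Take [S] of minimal cardinality: removing any element brings the sum below [r], and that element
    weighs at most 1. *)
Lemma trim_sum (R : realType) (C : finType) (f : C -> R) (r : R) :
  (forall c, f c <= 1) -> 0 <= r -> r <= \sum_c f c ->
  exists S : {set C}, r <= \sum_(c in S) f c <= r + 1.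
Proof.
move=> f1 r0 rf.
have rT : r <= \sum_(c in [set: C]) f c.
  by rewrite (eq_bigl predT) // => c; rewrite inE.
case: (arg_minnP (fun S : {set C} => #|S|) (P := fun S : {set C} => r <= \sum_(c in S) f c) rT).
move=> S rS minS; exists S; rewrite rS /=.
have [->|[c cS]] := set_0Vmem S; first by rewrite big_set0 addr_ge0.
rewrite (big_setD1 c) //= addrC lerD //.
case: (lerP (\sum_(c0 in S :\ c) f c0) r) => // /ltW/minS.
by rewrite (cardsD1 c S) cS ltnn.
Qed.

(** * Trimming lists and bounding degrees *)

Section Trim.
Variables (R : realType) (V C : finType) (n : nat) (b r : R).
Variables (E : {set {set V}}) (mu : {set V} -> C -> R).
Hypothesis wl : weighted_lists n b r E mu.

Lemma trim_lists : b <= 1 -> 0 <= r <= 32 ->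
  exists mu' : {set V} -> C -> R, [/\ weighted_lists n b r E mu',
    forall e, e \in E -> \sum_c mu' e c <= 33,
    forall e c, 0 < mu' e c -> mu' e c = mu e c &
    colourable E mu' -> colourable E mu].
Proof.
case: wl => sE mub ld rE deg sz b1 /andP[r0 r32].
have /fin_all_exists[S SP] (e : {set V}) : exists S : {set C},
    e \in E -> r <= \sum_(c in S) mu e c <= r + 1.
  have [eE|nE] := boolP (e \in E); last by exists set0.
  have [c|S HS] := trim_sum (_ : forall c, mu e c <= 1) r0 (rE e eE); last by exists S.
  by case/andP: (mub e c) => _ /le_trans->.
pose mu' e c := if c \in S e then mu e c else 0.
have le_mu' e c : mu' e c <= mu e c.
  by rewrite /mu'; case: ifP => // _; case/andP: (mub e c).
have sumE e : \sum_c mu' e c = \sum_(c in S e) mu e c by rewrite [RHS]big_mkcond.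
have pos e c : 0 < mu' e c -> mu' e c = mu e c.
  by rewrite /mu'; case: ifP; rewrite ?ltxx.
exists mu'; split => //.
- split => //.
  + move=> e c; case/andP: (mub e c) => m0 m1; rewrite (le_trans (le_mu' e c)) // andbT.
    by rewrite /mu'; case: ifP.
  + by move=> v c; apply: le_trans (ld v c); apply: ler_sum => e _; apply: le_mu'.
  + by move=> e /SP; rewrite sumE => /andP[].
  + move=> v c; apply: leq_trans (deg v c); apply: subset_leq_card; apply/subsetP => e.
    by rewrite !inE => /and3P[-> -> m0] /=; rewrite -(pos _ _ m0).
  + move=> e /sz; apply: leq_trans; apply: subset_leq_card; apply/subsetP => c.
    by rewrite !inE => m0; rewrite -(pos _ _ m0).
- by move=> e /SP; rewrite sumE; lra.
- case=> col [col_list col_proper]; exists col; split => // e /col_list m0.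
  by rewrite -(pos _ _ m0).
Qed.

(** Positive weights are at least [a], so a sum of at most 33 has at most 33 / [a] positive terms.
    This replaces an arbitrary initial [n] by one independent of the graph. *)
Lemma regrade_lists (a : R) (m : nat) : 33 <= a * m%:R -> 0 < a ->
  (forall e c, 0 < mu e c -> a <= mu e c) -> (forall e, e \in E -> \sum_c mu e c <= 33) ->
  weighted_lists m b r E mu.
Proof.
case: wl => sE mub ld rE _ _ am a0 amu le33; have mu0 e c : 0 <= mu e c by case/andP: (mub e c).
have bound (T : finType) (f : T -> R) (P : pred T) :
    (forall x, P x -> a <= f x) -> \sum_(x | P x) f x <= 33 -> (#|[set x | P x]| <= m)%N.
  move=> af f33; rewrite -(ler_nat R) -(ler_pM2l a0); apply: le_trans am.
  apply: le_trans f33; rewrite mulr_natr -sumr_const.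
  by rewrite (eq_bigl P) => [|x]; [apply: ler_sum | rewrite inE].
split => // [v c|e eE].
  apply: (bound _ (fun e => mu e c)) => [e /and3P[_ _ /amu]//|].
  apply: (@le_trans _ _ (load E mu v c)); last by apply: le_trans (ld v c) _; lra.
  rewrite /load big_mkcond [leRHS]big_mkcond; apply: ler_sum => e _.
  by case: (e \in E); case: (v \in e); case: (0 < mu e c); rewrite ?lexx ?mu0.
apply: (bound _ (mu e)) => [c /amu//|].
by apply: le_trans (le33 e eE); rewrite big_mkcond; apply: ler_sum => c _; case: ifP.
Qed.

End Trim.

Section Iteration.
Variables (R : realType) (eps : R).
Hypothesis eps01 : 0 < eps <= 1.

(* [slack] is the deviation allowed in each round, small enough (see
   [slack_eq]) for the ratio of list weight to load to grow by [expR gain];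
   [shrink] is the resulting bound on the new loads. *)
Definition rate : R := eps / 8.
Definition gain : R := rate * eps / 8.
Definition slack : R := expR (- (2 * rate)) * (1 - expR (- (2 * gain))) / (1 + expR gain).
Definition shrink : R := expR (- (2 * rate)) * expR (- (3 * gain)) + slack.

Lemma rate01 : 0 < rate <= 1.
Proof. by rewrite /rate; case/andP: eps01 => ? ?; apply/andP; split; lra. Qed.

Lemma gain_gt0 : 0 < gain.
Proof. by rewrite /gain divr_gt0 // mulr_gt0 //; [case/andP: rate01|case/andP: eps01]. Qed.

Lemma slack_gt0 : 0 < slack.
Proof.
rewrite /slack divr_gt0 ?addr_gt0 ?expR_gt0 // mulr_gt0 ?expR_gt0 // subr_gt0.
by rewrite -[ltRHS]expR0 ltr_expR oppr_lt0 mulr_gt0 ?gain_gt0.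
Qed.

Lemma slack_eq :
  slack * (1 + expR gain) = expR (- (2 * rate)) * (1 - expR (- (2 * gain))).
Proof. by rewrite /slack divfK // gt_eqF // addr_gt0 ?expR_gt0. Qed.

Let kappa_le1 : expR (- (2 * rate)) <= 1.
Proof. by rewrite expRN_le1 // mulr_ge0 //; case/andP: rate01 => /ltW. Qed.

Let slack_le : slack <= expR (- (2 * rate)) * (1 - expR (- (2 * gain))).
Proof. by rewrite -slack_eq ler_peMr ?(ltW slack_gt0) // lerDl expR_ge0. Qed.

Lemma slack_le1 : slack <= 1.
Proof.
apply: le_trans slack_le _; apply: mulr_ile1; rewrite ?expR_ge0 //.
  by rewrite subr_ge0 expRN_le1 // mulr_ge0 ?(ltW gain_gt0).
by rewrite gerBl expR_ge0.
Qed.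

Lemma shrink_gt0 : 0 < shrink.
Proof. by rewrite addr_gt0 ?slack_gt0 // mulr_gt0 ?expR_gt0. Qed.

Lemma shrink_le1 : shrink <= 1.
Proof.
have h : expR (- (3 * gain)) <= expR (- (2 * gain)) by rewrite ler_expR; have := gain_gt0; lra.
apply: (@le_trans _ _ (expR (- (2 * rate)))) => //; rewrite /shrink.
have := ler_wpM2l (expR_ge0 (- (2 * rate))) h; have := slack_le; rewrite mulrBr mulr1; lra.
Qed.

(** After cancelling [rate], the exponent must reach 2 + 3 eps/8. The list term gives (1 - eps/4)(1
    + eps) >= 1 + eps/2, and the two occurrences of [b] cost at most eps/8. *)
Lemma shrink_ge (b r : R) : 0 <= b <= eps / 16 -> 1 + eps <= r ->
  expR (- (rate * (1 - b)) - rate * expR (- (2 * rate)) * (r - b)) + slack <= shrink.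
Proof.
move=> /andP[b0 b16] r1; rewrite lerD2r -expRD ler_expR -mulrA -opprD -mulrDr -opprD lerN2.
rewrite (_ : 2 * rate + 3 * gain = rate * (2 + 3 * eps / 8)); last by rewrite /gain; field.
rewrite ler_wpM2l //; first by case/andP: rate01 => /ltW.
have := expR_ge1Dx (- (2 * rate)); set k := expR _ => hk.
have k0 : 0 <= k by apply: expR_ge0.
have kr : (1 - 2 * rate) * (1 + eps) <= k * r.
  apply: (@le_trans _ _ (k * (1 + eps))).
    by rewrite ler_wpM2r //; case/andP: eps01; lra.
  by rewrite ler_wpM2l.
have kb : k * b <= b by rewrite ler_piMl.
rewrite mulrBr; move: kr; rewrite /rate.
have -> : (1 - 2 * (eps / 8)) * (1 + eps) = 1 + eps / 2 + eps / 4 * (1 - eps) by field.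
have : 0 <= eps / 4 * (1 - eps) by case/andP: eps01 => e0 e1; rewrite mulr_ge0 ?subr_ge0 //; lra.
lra.
Qed.

Lemma shrink_gain (r : R) : 1 <= r ->
  (expR gain * r) * shrink <= expR (- (2 * rate)) * r - slack.
Proof.
move=> r1; rewrite /shrink mulrDr.
have -> : expR gain * r * (expR (- (2 * rate)) * expR (- (3 * gain))) =
   expR (- (2 * rate)) * (expR gain * expR (- (3 * gain))) * r by ring.
rewrite -(expRD gain) (_ : gain - 3 * gain = - (2 * gain)); last by ring.
have := slack_eq; rewrite mulrDr mulr1 mulrBr mulr1.
set k := expR (- (2 * rate)); set g := expR gain; set h := expR _ => e.
have -> : k * r = (slack + slack * g + k * h) * r by rewrite e subrK.
have : slack <= slack * r by rewrite ler_peMr // (ltW slack_gt0).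
have -> : (slack + slack * g + k * h) * r = slack * r + slack * g * r + k * h * r by ring.
have -> : g * r * slack = slack * g * r by ring.
lra.
Qed.

(** Induction on the remaining rounds [m]. Each round divides [b] by [shrink] and multiplies [r] by
    [expR gain], so both invariants pass to [m - 1]; [beta] bounds the weights in all rounds. *)
Lemma colourable_iter (V C : finType) (c0 : C) (n m : nat) (beta b r : R)
    (E : {set {set V}}) (mu : {set V} -> C -> R) :
  (0 < n)%N -> beta <= eps / 16 ->
  100 * n%:R ^+ 5 * expR (- (slack ^+ 2 / (544 * beta))) <= 1 ->
  0 < b -> b / shrink ^+ m <= beta -> 1 + eps <= r -> 32 <= expR gain ^+ m * r ->
  weighted_lists n b r E mu -> colourable E mu.
Proof.
move=> n0 beta16 small; have [e0 e1] := andP eps01.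
elim: m b r E mu => [|m IHm] b r E mu b0 bm r1 rm wl.
  move: rm; rewrite expr0 mul1r => r32; case: wl => sE mub ld rE _ _.
  apply: (colourable_of_long_lists c0) => // [e c|e eE]; first by case/andP: (mub e c).
  exact: le_trans (rE e eE).
(* The process may stop early; otherwise [r < 32], as [trim_lists] requires. *)
have [r32|r32] := lerP 32 r.
  case: wl => sE mub ld rE _ _.
  apply: (colourable_of_long_lists c0) => // [e c|e eE]; first by case/andP: (mub e c).
  exact: le_trans (rE e eE).
have b_le : b <= beta.
  apply: le_trans bm; rewrite ler_peMr ?(ltW b0) // invf_ge1 ?exprn_gt0 ?shrink_gt0 //.
  by rewrite exprn_ile1 ?shrink_le1 ?(ltW shrink_gt0).
have [|| mu' [wl' le33 _ back]] := trim_lists wl; [lra | lra |].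
apply: back.
have small' : 100 * n%:R ^+ 5 * expR (- (slack ^+ 2 / (544 * b))) <= 1.
  apply: le_trans small; rewrite ler_wpM2l ?mulr_ge0 ?exprn_ge0 // ler_expR lerN2.
  rewrite ler_wpM2l ?sqr_ge0 // lef_pV2 ?posrE; lra.
have t68 : 0 <= slack <= 68 by have := slack_gt0; have := slack_le1; lra.
have b16 : 0 <= b <= eps / 16 by lra.
have [|E' [mu'' [wl'' back]]] := nibble_step wl' le33 rate01 n0 b0 t68 small' shrink_gt0
  (shrink_ge b16 r1) (shrink_gain _); first lra.
apply: back; apply: IHm wl''.
- by rewrite divr_gt0 ?shrink_gt0.
- by rewrite -mulrA -invfM -exprS.
- have r0 : 0 <= r by lra.
  apply: le_trans r1 _.
  by rewrite ler_peMl // -[leLHS]expR0 ler_expR (ltW gain_gt0).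
- by rewrite mulrA -exprSr.
Qed.

End Iteration.

(** * Choice of the constants and reduction to finitely many colours *)

Theorem theorem1p6 (R : realType) :
  forall eps : R, 0 < eps ->
  exists delta0 : R, forall delta : R, delta0 <= delta ->
  forall (V : finType) (E : {set {set V}}) (L : {set V} -> seq nat)
         (mu : {set V} -> nat -> R),
    simple_graph E ->
    colour_lists E L ->
    (* (a) *)
    (forall e, e \in E -> forall c, c \in L e ->
        expR (- (delta `^ (1 / 25))) <= mu e c /\ mu e c <= delta^-1) ->
    (* (b) *)
    (forall e, e \in E -> 1 + eps <= \sum_(c <- L e) mu e c) ->
    (* (c) *)
    (forall (v : V) (c : nat),
        \sum_(e in E | (v \in e) && (c \in L e)) mu e c <= 1) ->
    exists col : {set V} -> nat, L_edge_colouring E L col.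
Proof.
move=> eps1 eps1_gt0; pose eps := Num.min eps1 1.
have eps01 : 0 < eps <= 1 by rewrite lt_min eps1_gt0 ltr01 ge_min lexx orbT.
have eps_le : eps <= eps1 by rewrite ge_min lexx.
clearbody eps; have [eps0 _] := andP eps01.
pose g := gain eps; have g0 : 0 < g by apply: gain_gt0.
(* Enough rounds for a total growth factor of at least 32; [m] and [s] depend on [eps] only. *)
pose m := (Num.trunc (32 / g)).+1.
have gm : 32 <= expR g ^+ m * (1 + eps).
  rewrite -expRM_natl; apply: (@le_trans _ _ (expR (m%:R * g))); last first.
    by rewrite ler_peMr ?expR_ge0 // lerDl ltW.
  apply: le_trans (expR_ge1Dx _); apply: (@le_trans _ _ (m%:R * g)); last by rewrite lerDr.
  by rewrite -ler_pdivrMr // ltW // truncnS_gt.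
pose s := shrink eps ^+ m; have s0 : 0 < s by rewrite exprn_gt0 // shrink_gt0.
pose k := slack eps ^+ 2 * s / 544.
have k0 : 0 < k by rewrite divr_gt0 // mulr_gt0 // exprn_gt0 // slack_gt0.
(* With [n <= 34 * expR y], the factor [100 * n ^+ 5] is at most [A * expR y ^+ 5]. *)
pose A : R := 100 * 34 ^+ 5.
have A0 : 0 <= A by rewrite mulr_ge0 ?exprn_ge0.
pose q := (A + 5) / k; have q0 : 0 <= q by rewrite divr_ge0 ?(ltW k0) // addr_ge0.
(* The summands ensure, in turn, [1 <= delta], final weights [delta^-1 / s] at most [eps / 16], and
   [q <= Num.sqrt delta]. *)
exists (1 + 16 / (eps * s) + q ^+ 2) => delta hdelta V E L mu sE cl mu_ab mu_eps ld.
have h16 : 0 <= 16 / (eps * s) by rewrite divr_ge0 // mulr_ge0 ?ltW.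
have hq2 := sqr_ge0 q.
have d1 : 1 <= delta by lra.
have d0 : 0 < delta by lra.
pose y := delta `^ (1 / 25); pose a := expR (- y).
have a0 : 0 < a by apply: expR_gt0.
have y0 : 0 <= y by apply: powR_ge0.
pose z := Num.sqrt delta.
have zz : z ^+ 2 = delta by rewrite sqr_sqrtr // ltW.
have z0 : 0 <= z by apply: sqrtr_ge0.
have z1 : 1 <= z by rewrite -sqrtr1 ler_wsqrtr.
have yz : y <= z.
  rewrite /y /z -powR12_sqrt ?(ltW d0) //; apply: ler_powR => //; lra.
have qz : q <= z by rewrite -(@ler_pXn2r _ 2) ?nnegrE // zz; lra.
pose n := (Num.trunc (33 / a)).+1.
have na : 33 <= a * n%:R by rewrite mulrC -ler_pdivrMr // ltW // truncnS_gt.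
have a1 : a <= 1 by apply: expRN_le1.
have n_le : n%:R <= 34 * expR y.
  have : (Num.trunc (33 / a))%:R <= 33 / a by rewrite truncn_le divr_ge0 // ltW.
  have e1 : 1 <= expR y by rewrite -expR0 ler_expR.
  rewrite /n -natr1 /a expRN invrK; lra.
have small : 100 * n%:R ^+ 5 * expR (- (slack eps ^+ 2 / (544 * (delta^-1 / s)))) <= 1.
  have -> : slack eps ^+ 2 / (544 * (delta^-1 / s)) = k * delta.
    by rewrite /k; field; rewrite !gt_eqF.
  apply: (@le_trans _ _ (A * expR y ^+ 5 * expR (- (k * delta)))).
    rewrite ler_wpM2r ?expR_ge0 // /A -mulrA -exprMn ler_wpM2l //.
    by rewrite lerXn2r ?nnegrE // mulr_ge0 ?expR_ge0.
  apply: (@le_trans _ _ (expR A * expR y ^+ 5 * expR (- (k * delta)))).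
    rewrite ler_wpM2r ?expR_ge0 // ler_wpM2r ?exprn_ge0 ?expR_ge0 //.
    by apply: le_trans (expR_ge1Dx _); rewrite lerDr.
  rewrite -expRM_natl -!expRD -[leRHS]expR0 ler_expR subr_le0 -zz expr2.
  (* It suffices that [A + 5 * y] is at most [k * delta]; since [y <= z] and [1 <= z], the left side
     is at most [(A + 5) * z]. *)
  have h1 : (A + 5) * z <= k * (z * z).
    rewrite mulrA ler_wpM2r //; move: qz; rewrite /q ler_pdivrMr // mulrC; lra.
  have h2 : A <= A * z by rewrite ler_peMr.
  rewrite mulrDl in h1; lra.
(* All listed colours are at most [M], so ['I_M.+1] serves as a finite colour type. *)
pose M := (\max_(e in E) \max_(c <- L e) c)%N.
have inM e c : e \in E -> c \in L e -> (c < M.+1)%N.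
  move=> eE cL; rewrite ltnS; apply: (@leq_trans (\max_(c <- L e) c)%N).
    exact: leq_bigmax_seq.
  exact: (leq_bigmax_cond (F := fun e => \max_(c <- L e) c)%N).
pose mu' (e : {set V}) (c : 'I_M.+1) :=
  if (e \in E) && (val c \in L e) then mu e c else 0.
have mu'_ab e c : 0 < mu' e c -> a <= mu' e c.
  by rewrite /mu'; case: ifP; rewrite ?ltxx // => /andP[eE cL]; case: (mu_ab e eE c cL).
(* The first argument is a crude count from the sizes of the types; once the lists are trimmed,
   [regrade_lists] replaces it by [n]. *)
have wl0 : weighted_lists (#|{set V}| + #|'I_M.+1|) delta^-1 (1 + eps) E mu'.
  split => //.
  - move=> e c; rewrite /mu'; case: ifP => [/andP[eE cL]|_].
      by have [la ->] := mu_ab e eE c cL; rewrite (le_trans (ltW a0) la).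
    by rewrite lexx invr_ge0 ltW.
  - move=> v c; apply: le_trans (ld v c).
    rewrite /load big_mkcond [leRHS]big_mkcond; apply: ler_sum => e _.
    rewrite /mu'; case: (e \in E) => //=; case: (v \in e) => //=.
  - move=> e eE; apply: (@le_trans _ _ (\sum_(c <- L e) mu e c)).
      by apply: le_trans (mu_eps e eE); rewrite lerD2l.
    rewrite /mu' eE /= -big_mkcond /= -(big_mkord (fun c => c \in L e) (mu e)).
    have [uL _] := cl e eE.
    have pm : perm_eq (L e) [seq c <- index_iota 0 M.+1 | c \in L e].
      apply: uniq_perm => // [|c]; first by rewrite filter_uniq ?iota_uniq.
      rewrite mem_filter mem_index_iota /=; case cL : (c \in L e) => //=.
      by rewrite (inM e).
    by rewrite (perm_big _ pm) big_filter.
  - by move=> v c; apply: leq_trans (max_card _) (leq_addr _ _).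
  - by move=> e eE; apply: leq_trans (max_card _) (leq_addl _ _).
have [|| mu'' [wl1 le33 eq_mu back]] := trim_lists wl0.
- by rewrite invf_le1.
- by case/andP: eps01; lra.
have wl2 : weighted_lists n delta^-1 (1 + eps) E mu''.
  apply: (regrade_lists wl1 na a0 _ le33) => e c m0.
  by rewrite (eq_mu e c m0) mu'_ab // -(eq_mu e c m0).
have beta16 : delta^-1 / s <= eps / 16.
  have h : 16 / (eps * s) <= delta by lra.
  move: h; rewrite ler_pdivrMr ?mulr_gt0 // => h.
  rewrite ler_pdivrMr // -[delta^-1]mul1r ler_pdivrMr //.
  have -> : eps / 16 * s * delta = delta * (eps * s) / 16 by ring.
  lra.
have [col [col_list col_proper]] : colourable E mu'.
  apply: back; apply: (colourable_iter eps01 ord0 _ beta16 small _ _ _ gm wl2) => //.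
  by rewrite invr_gt0.
exists (fun e => val (col e)); split.
  by move=> e /[dup] eE /col_list; rewrite /mu' eE /=; case: ifP; rewrite ?ltxx.
by move=> e f eE fE ef tef; apply: contra (col_proper e f eE fE ef tef) => /eqP /val_inj ->.
Qed.
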